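(* Let $0<q<1$ and $\mathrm{Re}\,\lambda=2$. Then the quantum Harish-Chandra module associated to $\tau_{q^\lambda}$ is unitarizable: $$\int_{S(\mathbb U)_q}f_2^*\,(\tau_{q^\lambda}(\xi)f_1)\,d\mu=\int_{S(\mathbb U)_q}(\tau_{q^\lambda}(\xi^* )f_2)^*f_1\,d\mu$$ for all $f_1,f_2\in\mathrm{Pol}(S(\mathbb U))_q$ and $\xi\in U_q\mathfrak g$, $\mathfrak g=\mathfrak{sl}_4$.
   Context: $0<q<1$, ground field $\mathbb C$. $U_q\mathfrak g=U_q\mathfrak{sl}_4$ is the Drinfeld–Jimbo Hopf algebra with generators $E_j,F_j,K_j^{\pm1}$, $j=1,2,3$, with $\Delta(E_j)=E_j\otimes1+K_j\otimes E_j$, $\Delta(F_j)=F_j\otimes K_j^{-1}+1\otimes F_j$, $\Delta(K_j)=K_j\otimes K_j$, $\varepsilon(E_j)=\varepsilon(F_j)=0$, $\varepsilon(K_j)=1$, $S(E_j)=-K_j^{-1}E_j$, $S(F_j)=-F_jK_j$, $S(K_j)=K_j^{-1}$, equipped with the involution $E_2^*=-K_2F_2$, $F_2^*=-E_2K_2^{-1}$, $K_2^*=K_2$, $E_j^*=K_jF_j$, $F_j^*=E_jK_j^{-1}$, $K_j^*=K_j$ for $j=1,3$. $U_q\mathfrak k$ is the Hopf subalgebra generated by $K_2^{\pm1}$, $E_j,F_j,K_j^{\pm1}$, $j=1,3$. A module $V$ is unitarizable if $(\xi v_1,v_2)=(v_1,\xi^*v_2)$ for some Hermitian scalar product (positive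 definite) and all $\xi\in U_q\mathfrak g$. A $U_q\mathfrak g$-module $*$-algebra is a $*$-algebra with a $U_q\mathfrak g$-action such that multiplication is a module morphism, $\xi1=\varepsilon(\xi)1$, and $(\xi f)^*=(S(\xi))^*f^*$. *$\mathrm{Pol}(S(\mathbb U))_q$.* $\mathbb C[\mathrm{Mat}_2]_q$ has generators $\alpha,\beta,\gamma,\delta$ and relations $\alpha\beta=q\beta\alpha$, $\gamma\delta=q\delta\gamma$, $\alpha\gamma=q\gamma\alpha$, $\beta\delta=q\delta\beta$, $\beta\gamma=\gamma\beta$, $\alpha\delta=\delta\alpha+(q-q^{-1})\beta\gamma$. It is a $U_q\mathfrak g$-module algebra with (values not listed are $0$): $E_1\beta=q^{-1/2}\alpha$, $E_1\delta=q^{-1/2}\gamma$; $E_3\gamma=q^{-1/2}\alpha$, $E_3\delta=q^{-1/2}\beta$; $F_1\alpha=q^{1/2}\beta$, $F_1\gamma=q^{1/2}\delta$; $F_3\alpha=q^{1/2}\gamma$, $F_3\beta=q^{1/2}\delta$; $K_1(\alpha,\beta,\gamma,\delta)=(q\alpha,q^{-1}\beta,q\gamma,q^{-1}\delta)$; $K_3(\alpha,\beta,\gamma,\delta)=(q\alpha,q\beta,q^{-1}\gamma,q^{-1}\delta)$; $E_2\alpha=-q^{-1/2}\beta\gamma$, $E_2\beta=-q^{1/2}\delta\beta$, $E_2\gamma=-q^{1/2}\delta\gamma$, $E_2\delta=-q^{1/2}\delta^2$; $F_2\delta=q^{1/2}$; $K_2(\alpha,\beta,\gamma,\delta)=(\alpha,q\beta,q\gamma,q^2\delta)$.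 Put $c=\alpha\delta-q\beta\gamma$; $\mathbb C[GL_2]_q$ is the localization with respect to $c^{\mathbb N}$, to which the module algebra structure extends uniquely. $\mathrm{Pol}(S(\mathbb U))_q=(\mathbb C[GL_2]_q,* )$ with $\alpha^*=q^{-2}c^{-1}\delta$, $\beta^*=-q^{-1}c^{-1}\gamma$, $\gamma^*=-q^{-1}c^{-1}\beta$, $\delta^*=c^{-1}\alpha$; it is a $U_q\mathfrak g$-module $*$-algebra. $f\mapsto\int_{S(\mathbb U)_q}f\,d\mu$ is the unique $U_q\mathfrak k$-invariant linear functional on it ($\mu(\xi f)=\varepsilon(\xi)\mu(f)$, $\xi\in U_q\mathfrak k$) with $\int1\,d\mu=1$; it is positive definite. *$\mathrm{Pol}(\widehat S(\mathbb U))_q$* is the $*$-algebra obtained from $\mathrm{Pol}(S(\mathbb U))_q$ by adding generators $t,t^{-1}$ and relations $tt^{-1}=t^{-1}t=1$, $tt^*=t^*t$, $zt=qtz$, $zt^*=qt^*z$ for $z\in\{\alpha,\beta,\gamma,\delta\}$. The $U_q\mathfrak g$-module $*$-algebra structure extends uniquely so that $E_jt=F_jt=0$, $K_jt=t$ for $j=1,3$, and $E_2t=q^{-1/2}t\delta$, $F_2t=0$, $K_2t=q^{-1}t$. *The representations $\tau_{q^\lambda}$* form the unique one-parameter family of representations of $U_q\mathfrak g$ in the space $\mathrm{Pol}(S(\mathbb U))_q$ such that (i) for all $\lambda\in-2\mathbb Z_+$, $\xi\in U_q\mathfrak g$, $f\in\mathrm{Pol}(S(\mathbb U))_q$: $(\tau_{q^\lambda}(\xi)f)\,c^{-\lambda/2}t^{-\lambda}=\xi(f\,c^{-\lambda/2}t^{-\lambda})$;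 (ii) for all $\xi,f$, $\tau_{q^\lambda}(\xi)f$ is a Laurent polynomial of the indeterminate $\zeta=q^\lambda$. *)

(* Defs.v *)
From HB Require Import structures.
From mathcomp Require Import all_boot all_order all_algebra.
From mathcomp Require Import generic_quotient complex.
From mathcomp Require Import boolp reals sequences exp trigo.

Set Implicit Arguments.
Unset Strict Implicit.
Unset Printing Implicit Defensive.
Import Order.TTheory GRing.Theory Num.Theory.

Local Open Scope ring_scope.
Local Open Scope quotient_scope.

(* The algebra K<G | R>: formal expressions in the generators, modulo the     *)
(* least congruence that contains R and the axioms of associative unital      *)
(* K-algebras.  It carries a pzRingType and an lmodType K structure, not an    *)
(* algType K one: GRing.Algebra demands 1 != 0, which depends on R.           *)
Inductive term (K G : Type) : Type :=
| TGen of G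
| TZero
| TOne
| TAdd of term K G & term K G
| TMul of term K G & term K G
| TScale of K & term K G.
Arguments TGen {K G} & _.
Arguments TZero {K G}.
Arguments TOne {K G}.
Arguments TAdd {K G} & _ _.
Arguments TMul {K G} & _ _.
Arguments TScale {K G} & _ _.

Declare Scope term_scope.
Delimit Scope term_scope with TM.
Bind Scope term_scope with term.
Notation "0" := TZero : term_scope.
Notation "1" := TOne : term_scope.
Infix "+" := TAdd : term_scope.
Infix "*" := TMul : term_scope.
Notation "a *: x" := (TScale a%R x) : term_scope.
Notation "x - y" := (TAdd x (TScale (-1)%R y)) : term_scope.

Section Presented.
Variables (K : pzRingType) (G : Type).
Implicit Types (x y z : term K G) (R : term K G -> term K G -> Prop).

Inductive cong R : term K G -> term K G -> Prop :=
| cong_rel x y : R x y -> cong R x y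
| cong_refl x : cong R x x
| cong_sym x y : cong R x y -> cong R y x
| cong_trans x y z : cong R x y -> cong R y z -> cong R x z
| cong_add x x' y y' : cong R x x' -> cong R y y' -> cong R (x + y) (x' + y')
| cong_mul x x' y y' : cong R x x' -> cong R y y' -> cong R (x * y) (x' * y')
| cong_scale a x x' : cong R x x' -> cong R (a *: x) (a *: x')
| cong_addA x y z : cong R (x + (y + z)) (x + y + z)
| cong_addC x y : cong R (x + y) (y + x)
| cong_add0 x : cong R (0 + x) x
| cong_addN x : cong R (x - x) 0
| cong_mulA x y z : cong R (x * (y * z)) (x * y * z)
| cong_1mul x : cong R (1 * x) x
| cong_mul1 x : cong R (x * 1) x
| cong_mulDl x y z : cong R ((x + y) * z) (x * z + y * z)
| cong_mulDr x y z : cong R (x * (y + z)) (x * y + x * z)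
| cong_scaleA a b x : cong R (a *: (b *: x)) ((a * b)%R *: x)
| cong_scale1 x : cong R (1%R *: x) x
| cong_scaleDr a x y : cong R (a *: (x + y)) (a *: x + a *: y)
| cong_scaleDl a b x : cong R ((a + b)%R *: x) (a *: x + b *: x)
| cong_scaleAl a x y : cong R (a *: (x * y)) ((a *: x) * y)
| cong_scaleAr a x y : cong R (a *: (x * y)) (x * (a *: y)).

HB.instance Definition _ := gen_eqMixin (term K G).
HB.instance Definition _ := gen_choiceMixin (term K G).

Section Quotient.
Variable R : term K G -> term K G -> Prop.

Definition congb : rel (term K G) := fun x y => `[< cong R x y >].

Fact congb_refl : reflexive congb.
Proof. by move=> x; apply/asboolP/cong_refl. Qed.

Fact congb_sym : symmetric congb.
Proof. by move=> x y; apply/asboolP/asboolP => /cong_sym. Qed.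

Fact congb_trans : transitive congb.
Proof.
by move=> y x z /asboolP xy /asboolP yz; apply/asboolP/(cong_trans xy).
Qed.

Canonical congb_equiv := EquivRel congb congb_refl congb_sym congb_trans.

Definition presAlg : Type := {eq_quot congb_equiv}.
HB.instance Definition _ := Choice.on presAlg.

Definition pclass (x : term K G) : presAlg := \pi_{eq_quot congb_equiv} x.
Definition prepr (u : presAlg) : term K G := repr (u : {eq_quot congb_equiv}).

Lemma preprK : cancel prepr pclass.
Proof. exact: (@reprK _ {eq_quot congb_equiv}). Qed.

Lemma eq_pclass x y : pclass x = pclass y <-> cong R x y.
Proof.
split=> [/eqmodP /asboolP //|xy].
by apply/eqmodP/asboolP.
Qed.

Lemma prepr_cong x : cong R (prepr (pclass x)) x.
Proof. by apply/eq_pclass; rewrite preprK. Qed.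

Definition pgen (g : G) : presAlg := pclass (TGen g).
Definition padd (u v : presAlg) := pclass (prepr u + prepr v).
Definition pmul (u v : presAlg) := pclass (prepr u * prepr v).
Definition pscale (a : K) (u : presAlg) := pclass (a *: prepr u).

Lemma paddE x y : padd (pclass x) (pclass y) = pclass (x + y).
Proof. by apply/eq_pclass/cong_add; exact: prepr_cong. Qed.

Lemma pmulE x y : pmul (pclass x) (pclass y) = pclass (x * y).
Proof. by apply/eq_pclass/cong_mul; exact: prepr_cong. Qed.

Lemma pscaleE a x : pscale a (pclass x) = pclass (a *: x).
Proof. by apply/eq_pclass/cong_scale; exact: prepr_cong. Qed.

Ltac plift :=
  repeat (let u := fresh "u" in move=> u);
  repeat match goal with u : presAlg |- _ => rewrite -(preprK u); move: (prepr u) => {u} u end;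
  rewrite ?(paddE, pmulE, pscaleE); apply/eq_pclass; by constructor.

Fact paddA : associative padd. Proof. plift. Qed.
Fact paddC : commutative padd. Proof. plift. Qed.
Fact padd0 : left_id (pclass 0) padd. Proof. plift. Qed.
Fact paddN : left_inverse (pclass 0) (pscale (-1)) padd.
Proof. move=> u; rewrite paddC; move: u; plift. Qed.
Fact pmulA : associative pmul. Proof. plift. Qed.
Fact p1mul : left_id (pclass 1) pmul. Proof. plift. Qed.
Fact pmul1 : right_id (pclass 1) pmul. Proof. plift. Qed.
Fact pmulDl : left_distributive pmul padd. Proof. plift. Qed.
Fact pmulDr : right_distributive pmul padd. Proof. plift. Qed.

HB.instance Definition _ :=
  GRing.isZmodule.Build presAlg paddA paddC padd0 paddN.
HB.instance Definition _ :=
  GRing.Zmodule_isPzRing.Build presAlg pmulA p1mul pmul1 pmulDl pmulDr.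

Fact pscaleA a b u : pscale a (pscale b u) = pscale (a * b) u.
Proof. move: u; plift. Qed.
Fact pscale1 : left_id 1 pscale. Proof. plift. Qed.
Fact pscaleDr : right_distributive pscale +%R.
Proof. rewrite /GRing.add /=; plift. Qed.
Fact pscaleDl u : {morph pscale^~ u : a b / a + b}.
Proof.
move=> a b; rewrite -(preprK u) !pscaleE [RHS]paddE.
exact/eq_pclass/cong_scaleDl.
Qed.

HB.instance Definition _ :=
  GRing.Zmodule_isLmodule.Build K presAlg pscaleA pscale1 pscaleDr pscaleDl.

Lemma pscalerAl (a : K) (u v : presAlg) : a *: (u * v) = (a *: u) * v.
Proof.
rewrite -(preprK u) -(preprK v) /GRing.scale /GRing.mul /=.
by rewrite pmulE !pscaleE pmulE; apply/eq_pclass/cong_scaleAl.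
Qed.
Lemma pscalerAr (a : K) (u v : presAlg) : a *: (u * v) = u * (a *: v).
Proof.
rewrite -(preprK u) -(preprK v) /GRing.scale /GRing.mul /=.
by rewrite pmulE !pscaleE pmulE; apply/eq_pclass/cong_scaleAr.
Qed.

End Quotient.

Inductive gen_subalg R (S : presAlg R -> Prop) : presAlg R -> Prop :=
| gen_subalg_in u : S u -> gen_subalg S u
| gen_subalg_1 : gen_subalg S 1%R
| gen_subalg_lin a u v :
    gen_subalg S u -> gen_subalg S v -> gen_subalg S (a *: u + v)%R
| gen_subalg_mul u v :
    gen_subalg S u -> gen_subalg S v -> gen_subalg S (u * v)%R.

End Presented.

Definition alg_morphism (K : pzRingType) (G1 G2 : Type)
    (P1 : term K G1 -> term K G1 -> Prop) (P2 : term K G2 -> term K G2 -> Prop)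
    (f : presAlg P1 -> presAlg P2) : Prop :=
  linear f /\ GRing.monoid_morphism f.

(* The algebra obtained from A by adding generators X and relations R; the    *)
(* letters TGen (inl a) stand for the elements of A.                          *)
Section Adjoin.
Variables (K : pzRingType) (G : Type) (P : term K G -> term K G -> Prop).
Local Notation A := (presAlg P).
Variable X : Type.
Variable R : term K (A + X) -> term K (A + X) -> Prop.

Inductive adjoin_rel : term K (A + X) -> term K (A + X) -> Prop :=
| adjoin_rel_lin (a : K) (x y : A) :
    adjoin_rel (TGen (inl (a *: x + y)%R)) (a *: TGen (inl x) + TGen (inl y))
| adjoin_rel_1 : adjoin_rel (TGen (inl 1%R)) 1
| adjoin_rel_mul (x y : A) :
    adjoin_rel (TGen (inl (x * y)%R)) (TGen (inl x) * TGen (inl y))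
| adjoin_rel_R x y : R x y -> adjoin_rel x y.

Definition adjoin := presAlg adjoin_rel.

Definition adjoin_in (x : A) : adjoin := pgen adjoin_rel (inl x).
Definition adjoin_gen (g : X) : adjoin := pgen adjoin_rel (inr g).

End Adjoin.

(* A (x) B, as the algebra generated by commuting copies of A and B.          *)
Section Tensor.
Variables (K : pzRingType) (G1 G2 : Type).
Variables (P1 : term K G1 -> term K G1 -> Prop).
Variables (P2 : term K G2 -> term K G2 -> Prop).
Local Notation A := (presAlg P1).
Local Notation B := (presAlg P2).

Inductive tensor_rel : term K (A + B) -> term K (A + B) -> Prop :=
| tensor_rel_linl (a : K) (x y : A) :
    tensor_rel (TGen (inl (a *: x + y)%R)) (a *: TGen (inl x) + TGen (inl y))
| tensor_rel_linr (a : K) (x y : B) :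
    tensor_rel (TGen (inr (a *: x + y)%R)) (a *: TGen (inr x) + TGen (inr y))
| tensor_rel_1l : tensor_rel (TGen (inl 1%R)) 1
| tensor_rel_1r : tensor_rel (TGen (inr 1%R)) 1
| tensor_rel_mull (x y : A) :
    tensor_rel (TGen (inl (x * y)%R)) (TGen (inl x) * TGen (inl y))
| tensor_rel_mulr (x y : B) :
    tensor_rel (TGen (inr (x * y)%R)) (TGen (inr x) * TGen (inr y))
| tensor_rel_comm (x : A) (y : B) :
    tensor_rel (TGen (inl x) * TGen (inr y)) (TGen (inr y) * TGen (inl x)).

Definition tensor := presAlg tensor_rel.

Definition tens (x : A) (y : B) : tensor :=
  pgen tensor_rel (inl x) * pgen tensor_rel (inr y).

End Tensor.

Local Open Scope complex_scope.

Section Modules.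
Variable R : realType.
Local Notation C := R[i].
Variables (GU GA : Type).
Variables (PU : term C GU -> term C GU -> Prop).
Variables (PA : term C GA -> term C GA -> Prop).
Local Notation U := (presAlg PU).
Local Notation A := (presAlg PA).

Definition representation (V : lmodType C) (act : U -> V -> V) : Prop :=
  [/\ forall xi, linear (act xi),
      forall v, linear (act^~ v),
      forall v, act 1 v = v &
      forall xi eta v, act (xi * eta) v = act xi (act eta v)].

Definition star_operation (star : A -> A) : Prop :=
  [/\ forall (a : C) x y, star (a *: x + y) = a^* *: star x + star y,
      star 1 = 1,
      forall x y, star (x * y) = star y * star x &
      involutive star].

Record hopf_star_maps := HopfStarMaps {
  coproduct : U -> tensor PU PU;
  counit : U -> C;
  antipode : U -> U;
  involution : U -> U
}.

(* In the last clause Delta(xi) is written as a finite sum of pure tensors.   *)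
Definition module_algebra (H : hopf_star_maps) (act : U -> A -> A) : Prop :=
  [/\ representation act,
      forall xi, act xi 1 = counit H xi *: (1 : A) &
      forall xi (s : seq (U * U)),
        coproduct H xi = \sum_(p <- s) tens p.1 p.2 ->
        forall f g, act xi (f * g) = \sum_(p <- s) act p.1 f * act p.2 g].

Definition module_star_algebra (H : hopf_star_maps) (act : U -> A -> A)
    (star : A -> A) : Prop :=
  [/\ module_algebra H act,
      star_operation star &
      forall xi f, star (act xi f) = act (involution H (antipode H xi)) (star f)].

Definition unitarizable (H : hopf_star_maps) (V : lmodType C)
    (act : U -> V -> V) : Prop :=
  exists ip : V -> V -> C,
    [/\ forall v2, scalar (ip^~ v2),
        forall v1 v2, ip v2 v1 = (ip v1 v2)^*,
        forall v, v != 0 -> 0 < ip v v &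
        forall xi v1 v2, ip (act xi v1) v2 = ip v1 (act (involution H xi) v2)].

End Modules.

Section QuantumAlgebras.
Variables (R : realType) (q : R).
Local Notation C := R[i].

Definition qC : C := q%:C.
Definition sqrtqC : C := (Num.sqrt q)%:C.

(* q^lambda, for 0 < q. *)
Definition qpow (lambda : C) : C :=
  (expR (complex.Re lambda * ln q))%:C *
  (cos (complex.Im lambda * ln q) +i* sin (complex.Im lambda * ln q)).

(* 'I_3 counts from 0: j1, j2, j3 are the nodes 1, 2, 3.                      *)
Definition j1 : 'I_3 := @Ordinal 3 0 isT.
Definition j2 : 'I_3 := @Ordinal 3 1 isT.
Definition j3 : 'I_3 := @Ordinal 3 2 isT.

Definition adjacent (i j : 'I_3) : bool :=
  (i.+1 == j :> nat) || (j.+1 == i :> nat).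

Definition cartan (i j : 'I_3) : int :=
  if i == j then 2 else if adjacent i j then -1 else 0.

Inductive Ugen := UE of 'I_3 | UF of 'I_3 | UK of 'I_3 | UKi of 'I_3.

Inductive Urel : term C Ugen -> term C Ugen -> Prop :=
| Urel_KKi i : Urel (TGen (UK i) * TGen (UKi i)) 1
| Urel_KiK i : Urel (TGen (UKi i) * TGen (UK i)) 1
| Urel_KK i j : Urel (TGen (UK i) * TGen (UK j)) (TGen (UK j) * TGen (UK i))
| Urel_KE i j : Urel (TGen (UK i) * TGen (UE j))
    ((qC ^ cartan i j) *: (TGen (UE j) * TGen (UK i)))
| Urel_KF i j : Urel (TGen (UK i) * TGen (UF j))
    ((qC ^ (- cartan i j)) *: (TGen (UF j) * TGen (UK i)))
| Urel_EF i : Urel (TGen (UE i) * TGen (UF i) - TGen (UF i) * TGen (UE i))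
    ((qC - qC^-1)^-1 *: (TGen (UK i) - TGen (UKi i)))
| Urel_EF0 i j : i != j ->
    Urel (TGen (UE i) * TGen (UF j)) (TGen (UF j) * TGen (UE i))
| Urel_EE i j : i != j -> ~~ adjacent i j ->
    Urel (TGen (UE i) * TGen (UE j)) (TGen (UE j) * TGen (UE i))
| Urel_FF i j : i != j -> ~~ adjacent i j ->
    Urel (TGen (UF i) * TGen (UF j)) (TGen (UF j) * TGen (UF i))
| Urel_serreE i j : adjacent i j ->
    Urel (TGen (UE i) * TGen (UE i) * TGen (UE j)
          - (qC + qC^-1) *: (TGen (UE i) * TGen (UE j) * TGen (UE i))
          + TGen (UE j) * TGen (UE i) * TGen (UE i)) 0
| Urel_serreF i j : adjacent i j ->
    Urel (TGen (UF i) * TGen (UF i) * TGen (UF j)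
          - (qC + qC^-1) *: (TGen (UF i) * TGen (UF j) * TGen (UF i))
          + TGen (UF j) * TGen (UF i) * TGen (UF i)) 0.

Definition Uqsl4 := presAlg Urel.

Definition E_ i : Uqsl4 := pgen Urel (UE i).
Definition F_ i : Uqsl4 := pgen Urel (UF i).
Definition K_ i : Uqsl4 := pgen Urel (UK i).
Definition Ki_ i : Uqsl4 := pgen Urel (UKi i).

(* The Hopf *-algebra structure is determined by its values on generators.    *)
Record Uqsl4_hopf_star (H : hopf_star_maps Urel) : Prop := {
  coproduct_morph : alg_morphism (coproduct H);
  coproductE : forall j,
    coproduct H (E_ j) = tens (E_ j) 1 + tens (K_ j) (E_ j);
  coproductF : forall j,
    coproduct H (F_ j) = tens (F_ j) (Ki_ j) + tens 1 (F_ j);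
  coproductK : forall j, coproduct H (K_ j) = tens (K_ j) (K_ j);
  counit_scalar : scalar (counit H);
  counit_monoid : GRing.monoid_morphism (counit H);
  counitE : forall j, counit H (E_ j) = 0;
  counitF : forall j, counit H (F_ j) = 0;
  counitK : forall j, counit H (K_ j) = 1;
  antipode_linear : linear (antipode H);
  antipode_1 : antipode H 1 = 1;
  antipode_mul : forall xi eta,
    antipode H (xi * eta) = antipode H eta * antipode H xi;
  antipodeE : forall j, antipode H (E_ j) = - (Ki_ j * E_ j);
  antipodeF : forall j, antipode H (F_ j) = - (F_ j * K_ j);
  antipodeK : forall j, antipode H (K_ j) = Ki_ j;
  involution_star : star_operation (involution H);
  involutionE2 : involution H (E_ j2) = - (K_ j2 * F_ j2);
  involutionF2 : involution H (F_ j2) = - (E_ j2 * Ki_ j2);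
  involutionE : forall j, j != j2 -> involution H (E_ j) = K_ j * F_ j;
  involutionF : forall j, j != j2 -> involution H (F_ j) = E_ j * Ki_ j;
  involutionK : forall j, involution H (K_ j) = K_ j
}.

Inductive Uqk_gen : Uqsl4 -> Prop :=
| Uqk_genK j : Uqk_gen (K_ j)
| Uqk_genKi j : Uqk_gen (Ki_ j)
| Uqk_genE j : j != j2 -> Uqk_gen (E_ j)
| Uqk_genF j : j != j2 -> Uqk_gen (F_ j).

Definition Uqk : Uqsl4 -> Prop := gen_subalg Uqk_gen.

Inductive Mgen := Ma | Mb | Mg | Md.

Inductive Mrel : term C Mgen -> term C Mgen -> Prop :=
| Mrel_ab : Mrel (TGen Ma * TGen Mb) (qC *: (TGen Mb * TGen Ma))
| Mrel_gd : Mrel (TGen Mg * TGen Md) (qC *: (TGen Md * TGen Mg))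
| Mrel_ag : Mrel (TGen Ma * TGen Mg) (qC *: (TGen Mg * TGen Ma))
| Mrel_bd : Mrel (TGen Mb * TGen Md) (qC *: (TGen Md * TGen Mb))
| Mrel_bg : Mrel (TGen Mb * TGen Mg) (TGen Mg * TGen Mb)
| Mrel_ad : Mrel (TGen Ma * TGen Md)
    (TGen Md * TGen Ma + (qC - qC^-1) *: (TGen Mb * TGen Mg)).

Definition Mat2q := presAlg Mrel.

Definition Mat2q_gen (z : Mgen) : Mat2q := pgen Mrel z.

Definition qdet : Mat2q :=
  Mat2q_gen Ma * Mat2q_gen Md - qC *: (Mat2q_gen Mb * Mat2q_gen Mg).

(* Localization at the powers of c = qdet: adjoin a two-sided inverse of c.   *)
Inductive GLrel : term C (Mat2q + unit) -> term C (Mat2q + unit) -> Prop :=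
| GLrel_r : GLrel (TGen (inl qdet) * TGen (inr tt)) 1
| GLrel_l : GLrel (TGen (inr tt) * TGen (inl qdet)) 1.

Definition GL2q := adjoin GLrel.

Definition GL2q_gen (z : Mgen) : GL2q := adjoin_in GLrel (Mat2q_gen z).
Definition al : GL2q := GL2q_gen Ma.
Definition be : GL2q := GL2q_gen Mb.
Definition ga : GL2q := GL2q_gen Mg.
Definition de : GL2q := GL2q_gen Md.
Definition c_ : GL2q := adjoin_in GLrel qdet.
Definition ci_ : GL2q := adjoin_gen GLrel tt.

(* Pol(S(U))_q: the action and the involution on C[GL_2]_q, both determined   *)
(* by their values on alpha, beta, gamma, delta.                              *)
Record PolSU_structure (H : hopf_star_maps Urel)
    (act : Uqsl4 -> GL2q -> GL2q) (star : GL2q -> GL2q) : Prop := {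
  PolSU_module : module_star_algebra H act star;
  actE1 : [/\ act (E_ j1) al = 0, act (E_ j1) be = sqrtqC^-1 *: al,
              act (E_ j1) ga = 0 & act (E_ j1) de = sqrtqC^-1 *: ga];
  actE3 : [/\ act (E_ j3) al = 0, act (E_ j3) be = 0,
              act (E_ j3) ga = sqrtqC^-1 *: al &
              act (E_ j3) de = sqrtqC^-1 *: be];
  actF1 : [/\ act (F_ j1) al = sqrtqC *: be, act (F_ j1) be = 0,
              act (F_ j1) ga = sqrtqC *: de & act (F_ j1) de = 0];
  actF3 : [/\ act (F_ j3) al = sqrtqC *: ga, act (F_ j3) be = sqrtqC *: de,
              act (F_ j3) ga = 0 & act (F_ j3) de = 0];
  actK1 : [/\ act (K_ j1) al = qC *: al, act (K_ j1) be = qC^-1 *: be,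
              act (K_ j1) ga = qC *: ga & act (K_ j1) de = qC^-1 *: de];
  actK3 : [/\ act (K_ j3) al = qC *: al, act (K_ j3) be = qC *: be,
              act (K_ j3) ga = qC^-1 *: ga & act (K_ j3) de = qC^-1 *: de];
  actE2 : [/\ act (E_ j2) al = - sqrtqC^-1 *: (be * ga),
              act (E_ j2) be = - sqrtqC *: (de * be),
              act (E_ j2) ga = - sqrtqC *: (de * ga) &
              act (E_ j2) de = - sqrtqC *: de ^+ 2];
  actF2 : [/\ act (F_ j2) al = 0, act (F_ j2) be = 0,
              act (F_ j2) ga = 0 & act (F_ j2) de = sqrtqC *: (1 : GL2q)];
  actK2 : [/\ act (K_ j2) al = al, act (K_ j2) be = qC *: be,
              act (K_ j2) ga = qC *: ga & act (K_ j2) de = qC ^+ 2 *: de];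
  star_al : star al = qC ^- 2 *: (ci_ * de);
  star_be : star be = - qC^-1 *: (ci_ * ga);
  star_ga : star ga = - qC^-1 *: (ci_ * be);
  star_de : star de = ci_ * al
}.

Record invariant_integral (H : hopf_star_maps Urel)
    (act : Uqsl4 -> GL2q -> GL2q) (star : GL2q -> GL2q) (mu : GL2q -> C) :
    Prop := {
  integral_scalar : scalar mu;
  integral_invariant : forall xi f, Uqk xi ->
    mu (act xi f) = counit H xi * mu f;
  integral_1 : mu 1 = 1;
  integral_pos_def : forall f, f != 0 -> 0 < mu (star f * f)
}.

(* Adding t, t^-1 to a *-algebra also adds t^* and (t^-1)^*.  The adjoints of *)
(* the relations z t = q t z and z t^* = q t^* z follow from these relations. *)
Inductive tgen := Tt | Tti | Tts | Ttis.

Local Notation tg x := (TGen (inr x)).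

Inductive hatrel : term C (GL2q + tgen) -> term C (GL2q + tgen) -> Prop :=
| hatrel_tti : hatrel (tg Tt * tg Tti) 1
| hatrel_tit : hatrel (tg Tti * tg Tt) 1
| hatrel_tstis : hatrel (tg Tts * tg Ttis) 1
| hatrel_tists : hatrel (tg Ttis * tg Tts) 1
| hatrel_tts : hatrel (tg Tt * tg Tts) (tg Tts * tg Tt)
| hatrel_zt (z : Mgen) : hatrel (TGen (inl (GL2q_gen z)) * tg Tt)
    (qC *: (tg Tt * TGen (inl (GL2q_gen z))))
| hatrel_zts (z : Mgen) : hatrel (TGen (inl (GL2q_gen z)) * tg Tts)
    (qC *: (tg Tts * TGen (inl (GL2q_gen z)))).

Definition hatS := adjoin hatrel.

Definition hat_in (f : GL2q) : hatS := adjoin_in hatrel f.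
Definition t_ : hatS := adjoin_gen hatrel Tt.
Definition ts_ : hatS := adjoin_gen hatrel Tts.

Record PolhatSU_structure (H : hopf_star_maps Urel)
    (act : Uqsl4 -> GL2q -> GL2q) (star : GL2q -> GL2q)
    (hact : Uqsl4 -> hatS -> hatS) (hstar : hatS -> hatS) : Prop := {
  PolhatSU_module : module_star_algebra H hact hstar;
  hact_in : forall xi f, hact xi (hat_in f) = hat_in (act xi f);
  hstar_in : forall f, hstar (hat_in f) = hat_in (star f);
  hstar_t : hstar t_ = ts_;
  hactE : forall j, j != j2 -> hact (E_ j) t_ = 0;
  hactF : forall j, j != j2 -> hact (F_ j) t_ = 0;
  hactK : forall j, j != j2 -> hact (K_ j) t_ = t_;
  hactE2 : hact (E_ j2) t_ = sqrtqC^-1 *: (t_ * hat_in de);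
  hactF2 : hact (F_ j2) t_ = 0;
  hactK2 : hact (K_ j2) t_ = qC^-1 *: t_
}.

(* tau zeta stands for tau_zeta; only the parameters zeta = q^lambda matter.  *)
(* In tau_ext, lambda = - 2 k.                                                *)
Record tau_family (hact : Uqsl4 -> hatS -> hatS)
    (tau : C -> Uqsl4 -> GL2q -> GL2q) : Prop := {
  tau_rep : forall lambda, representation (tau (qpow lambda));
  tau_ext : forall (k : nat) xi f,
    hat_in (tau (qpow (- (2 * k)%:R)) xi f) * hat_in (c_ ^+ k) * t_ ^+ (2 * k) =
    hact xi (hat_in f * hat_in (c_ ^+ k) * t_ ^+ (2 * k));
  tau_laurent : forall xi f, exists (n m : nat) (a : nat -> GL2q),
    forall lambda, tau (qpow lambda) xi f =
      \sum_(i < n) (qpow lambda ^ (i%:Z - m%:Z)) *: a i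
}.

End QuantumAlgebras.

(* Main.v *)
Require Import Defs.
From mathcomp Require Import all_boot all_order all_algebra.
From mathcomp Require Import complex reals sequences exp trigo zify ring.
Import Order.TTheory GRing.Theory Num.Theory.
Set Implicit Arguments.
Unset Strict Implicit.
Unset Printing Implicit Defensive.
Local Open Scope ring_scope.
Local Open Scope complex_scope.

(** Why the representation is unitary for Re lambda = 2.

    The elements xi of the quantum algebra that satisfy the adjointness relation with
    respect to the sesquilinear form mu(f2^* f1) form a subalgebra stable under the
    involution ([adjointM], [adjoint_lin], [adjoint_involution]), so that only the
    generators E_j and K_j have to be treated.  For K_j, and for E_j with j = 1, 3, the
    operator tau(xi) is the original action, and adjointness is the invariance of the
    integral ([adjoint_K], [adjoint_E13]).

    For the middle node, the Leibniz rule on f c^k t^(2k) gives tau at z = q^(-2k):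
      tau_z(E_2) f = E_2 f + kappa(z) (K_2 f) delta,
      tau_z(F_2) f = F_2 f + nu(z) f alpha c^-1,
    with kappa affine in z and nu affine in 1 / z.  Both sides are Laurent polynomials
    in z, so the formulas hold for all z = q^lambda ([tau_interpolation]).  That the
    values at q^(-2k) are determined at all rests on the embedding of the function
    algebra in its extension by t, which is proved by letting the extension act on the
    function algebra ([hat_in_inj]).

    Adjointness for E_2 then reads, for every function phi,
      mu(E_2 phi) + q^-2 kappa(z) mu(phi delta) + q^-2 (nu(z))^* mu(delta phi) = 0.
    It follows from two properties of the integral ([mu_de_act_E2]),
      mu(phi delta) = q^-2 mu(delta phi),
      mu(E_2 phi) = q^(-7/2) (1 + q^2) mu(delta phi),
    together with |z| = q^2, which makes the conjugate of nu(z) affine in z and cancels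
    the three coefficients ([nu_conj], [adjoint_E2]).

    Both properties are checked on monomials.  Since the integral kills every vector of
    non-zero weight, only phi = alpha c^-1 x^k with x = beta gamma c^-1 matters, and the
    properties become relations between the moments of x of order k and k + 1.  The one
    relation needed is the invariance under E_1 of the integral of x^k beta delta c^-1
    ([moment_rec]). *)

(** * Algebras given by generators and relations *)

Section PresentedOperators.
Variables (K : fieldType) (G : Type) (P : term K G -> term K G -> Prop).

Lemma presAlg_ind (Q : presAlg P -> Prop) :
    (forall g, Q (pgen P g)) -> Q 1 ->
    (forall a u v, Q u -> Q v -> Q (a *: u + v)) ->
    (forall u v, Q u -> Q v -> Q (u * v)) ->
  forall u, Q u.
Proof.
move=> Qg Q1 Ql Qm u; rewrite -(preprK u); move: (prepr u) => {u}.
have Q0 : Q 0 by have := Ql (-1) 1 1 Q1 Q1; rewrite scaleN1r addNr.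
elim=> [g|||x Qx y Qy|x Qx y Qy|a x Qx].
- exact: Qg.
- exact: Q0.
- exact: Q1.
- by have := Ql 1 _ _ Qx Qy; rewrite scale1r -paddE.
- by have := Qm _ _ Qx Qy; rewrite -pmulE.
- by have := Ql a _ _ Qx Q0; rewrite addr0 -pscaleE.
Qed.

(** Representations, and not algebra morphisms, are built from operators on the
    generators.  An endomorphism of the algebra itself is then read off at 1 from a
    representation by operators that commute with right multiplications. *)
Variables (V : lmodType K) (rho : G -> V -> V).

Fixpoint term_op (x : term K G) : V -> V :=
  match x with
  | TGen g => rho g
  | TZero => fun=> 0
  | TOne => id
  | TAdd x y => fun v => term_op x v + term_op y v
  | TMul x y => fun v => term_op x (term_op y v)
  | TScale a x => fun v => a *: term_op x v
  end.

Hypothesis rho_linear : forall g, linear (rho g).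
Hypothesis rho_rel : forall x y, P x y -> term_op x =1 term_op y.

Lemma term_op_linear x : linear (term_op x).
Proof.
elim: x => [g|||x lx y ly|x lx y ly|b x lx] a u v //=.
- exact: rho_linear.
- by rewrite scaler0 addr0.
- by rewrite lx ly scalerDr addrACA.
- by rewrite ly lx.
- by rewrite lx scalerDr !scalerA mulrC.
Qed.

Lemma term_op_cong x y : cong P x y -> term_op x =1 term_op y.
Proof.
elim=> {x y} //=.
- by move=> x y _ e v.
- by move=> x y z _ e _ e' v; rewrite e e'.
- by move=> x x' y y' _ e _ e' v; rewrite e e'.
- by move=> x x' y y' _ e _ e' v; rewrite e' e.
- by move=> a x x' _ e v; rewrite e.
- by move=> x y z v; rewrite addrA.
- by move=> x y v; rewrite addrC.
- by move=> x v; rewrite add0r.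
- by move=> x v; rewrite scaleN1r subrr.
- move=> x y z v.
  by have := term_op_linear x 1 (term_op y v) (term_op z v); rewrite !scale1r.
- by move=> a b x v; rewrite scalerA.
- by move=> x v; rewrite scale1r.
- by move=> a x y v; rewrite scalerDr.
- by move=> a b x v; rewrite scalerDl.
- move=> a x y v.
  have lx0 : term_op x 0 = 0.
    by have := term_op_linear x (-1) 0 0; rewrite scaler0 addr0 scaleN1r addNr.
  by have := term_op_linear x a (term_op y v) 0; rewrite !addr0 lx0 addr0.
Qed.

Definition pres_op (u : presAlg P) : V -> V := term_op (prepr u).

Lemma pres_opE x : pres_op (pclass P x) =1 term_op x.
Proof. exact/term_op_cong/prepr_cong. Qed.

Lemma pres_op_linear u : linear (pres_op u).
Proof. exact: term_op_linear. Qed.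

Lemma pres_op_lin a u u' v :
  pres_op (a *: u + u') v = a *: pres_op u v + pres_op u' v.
Proof.
rewrite -(preprK u) -(preprK u') -[_ + _]/(padd (pscale a _) _).
by rewrite pscaleE paddE !pres_opE.
Qed.

Lemma pres_op1 v : pres_op 1 v = v.
Proof. by rewrite pres_opE. Qed.

Lemma pres_opM u u' v : pres_op (u * u') v = pres_op u (pres_op u' v).
Proof.
by rewrite -(preprK u) -(preprK u') -[_ * _]/(pmul _ _) pmulE !pres_opE.
Qed.

Lemma pres_op_gen g v : pres_op (pgen P g) v = rho g v.
Proof. by rewrite pres_opE. Qed.

End PresentedOperators.

Section PresentedAlgebra.
Variables (K : fieldType) (G : Type) (P : term K G -> term K G -> Prop).
Implicit Types u v : presAlg P.

Lemma presZl (a : K) u v : (a *: u) * v = a *: (u * v).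
Proof. exact/esym/pscalerAl. Qed.

Lemma presZr (a : K) u v : u * (a *: v) = a *: (u * v).
Proof. exact/esym/pscalerAr. Qed.

Definition qcomm (a : K) u v := u * v = a *: (v * u).

Lemma qcommMl a b u v w : qcomm a u w -> qcomm b v w -> qcomm (a * b) (u * v) w.
Proof.
move=> uw vw.
by rewrite /qcomm -mulrA vw presZr mulrA uw presZl -mulrA scalerA mulrC.
Qed.

Lemma qcommMr a b u v w : qcomm a u v -> qcomm b u w -> qcomm (a * b) u (v * w).
Proof.
move=> uv uw.
by rewrite /qcomm mulrA uv presZl -mulrA uw presZr scalerA mulrA.
Qed.

Lemma qcommXl a u w n : qcomm a u w -> qcomm (a ^+ n) (u ^+ n) w.
Proof.
move=> uw; elim: n => [|n IHn]; first by rewrite /qcomm !expr0 mul1r mulr1 scale1r.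
by rewrite !exprS; exact: qcommMl.
Qed.

Lemma qcommXr a u w n : qcomm a u w -> qcomm (a ^+ n) u (w ^+ n).
Proof.
move=> uw; elim: n => [|n IHn]; first by rewrite /qcomm !expr0 mul1r mulr1 scale1r.
by rewrite !exprS; exact: qcommMr.
Qed.

Lemma qcomm1 u v : qcomm 1 u v <-> GRing.comm u v.
Proof. by rewrite /qcomm scale1r. Qed.

Lemma qcomm_sym a u v : a != 0 -> qcomm a u v -> qcomm a^-1 v u.
Proof. by move=> a0 uv; rewrite /qcomm uv scalerA mulVf // scale1r. Qed.

End PresentedAlgebra.

Section Adjunction.
Variables (K : fieldType) (G : Type) (P : term K G -> term K G -> Prop).
Variables (X : Type) (R : term K (presAlg P + X) -> term K (presAlg P + X) -> Prop).

Lemma adjoin_in_lin (a : K) (x y : presAlg P) :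
  adjoin_in R (a *: x + y) = a *: adjoin_in R x + adjoin_in R y.
Proof.
rewrite -[RHS]/(padd (pscale a _) _) pscaleE paddE.
exact/eq_pclass/cong_rel/adjoin_rel_lin.
Qed.

Lemma adjoin_in1 : adjoin_in R 1 = 1.
Proof. exact/eq_pclass/cong_rel/adjoin_rel_1. Qed.

Lemma adjoin_inM (x y : presAlg P) :
  adjoin_in R (x * y) = adjoin_in R x * adjoin_in R y.
Proof.
rewrite -[RHS]/(pmul _ _) pmulE.
exact/eq_pclass/cong_rel/adjoin_rel_mul.
Qed.

Lemma adjoin_in0 : adjoin_in R 0 = 0.
Proof. by have := adjoin_in_lin (-1) 0 0; rewrite scaler0 addr0 scaleN1r addNr. Qed.

Lemma adjoin_inZ (a : K) (x : presAlg P) : adjoin_in R (a *: x) = a *: adjoin_in R x.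
Proof. by have := adjoin_in_lin a x 0; rewrite adjoin_in0 !addr0. Qed.

Lemma adjoin_inD (x y : presAlg P) :
  adjoin_in R (x + y) = adjoin_in R x + adjoin_in R y.
Proof. by have := adjoin_in_lin 1 x y; rewrite !scale1r. Qed.

Lemma adjoin_inX (x : presAlg P) n : adjoin_in R (x ^+ n) = adjoin_in R x ^+ n.
Proof.
elim: n => [|n IHn]; first by rewrite !expr0 adjoin_in1.
by rewrite !exprS adjoin_inM IHn.
Qed.

End Adjunction.

(** * Functions on the quantum group GL(2) *)

Section GL2q.
Variables (R : realType) (q : R).
Local Notation C := R[i].
Local Notation qC := (qC q).
Local Notation A := (GL2q q).
Local Notation al := (al q).
Local Notation be := (be q).
Local Notation ga := (ga q).
Local Notation de := (de q).
Local Notation c := (c_ q).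
Local Notation ci := (ci_ q).

Lemma GL2q_rel (x y : term C Mgen) : Mrel q x y ->
  adjoin_in (@GLrel R q) (pclass _ x) = adjoin_in (@GLrel R q) (pclass (Mrel q) y).
Proof. by move=> xy; congr adjoin_in; exact/eq_pclass/cong_rel. Qed.

Lemma al_be : qcomm qC al be.
Proof.
have := GL2q_rel (Mrel_ab q).
by rewrite -pscaleE -!pmulE adjoin_inZ !adjoin_inM.
Qed.
Lemma ga_de : qcomm qC ga de.
Proof.
have := GL2q_rel (Mrel_gd q).
by rewrite -pscaleE -!pmulE adjoin_inZ !adjoin_inM.
Qed.
Lemma al_ga : qcomm qC al ga.
Proof.
have := GL2q_rel (Mrel_ag q).
by rewrite -pscaleE -!pmulE adjoin_inZ !adjoin_inM.
Qed.
Lemma be_de : qcomm qC be de.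
Proof.
have := GL2q_rel (Mrel_bd q).
by rewrite -pscaleE -!pmulE adjoin_inZ !adjoin_inM.
Qed.
Lemma be_ga : be * ga = ga * be.
Proof.
have := GL2q_rel (Mrel_bg q).
by rewrite -!pmulE !adjoin_inM.
Qed.
Lemma al_de_de_al : al * de = de * al + (qC - qC^-1) *: (be * ga).
Proof.
have := GL2q_rel (Mrel_ad q).
by rewrite -paddE -pscaleE -!pmulE adjoin_inD adjoin_inZ !adjoin_inM.
Qed.
Lemma c_def : c = al * de - qC *: (be * ga).
Proof.
rewrite /c_ /qdet -scaleN1r scalerA addrC adjoin_in_lin !adjoin_inM.
by rewrite addrC mulN1r scaleNr.
Qed.
Lemma c_ci : c * ci = 1.
Proof.
rewrite -[LHS]/(pmul _ _) pmulE.
exact/eq_pclass/cong_rel/adjoin_rel_R/GLrel_r.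
Qed.
Lemma ci_c : ci * c = 1.
Proof.
rewrite -[LHS]/(pmul _ _) pmulE.
exact/eq_pclass/cong_rel/adjoin_rel_R/GLrel_l.
Qed.

Lemma al_de : al * de = c + qC *: (be * ga).
Proof. by rewrite c_def subrK. Qed.

Lemma de_al : de * al = c + qC^-1 *: (be * ga).
Proof.
apply: (addIr ((qC - qC^-1) *: (be * ga))).
by rewrite -al_de_de_al al_de -addrA -scalerDl addrCA subrr addr0.
Qed.

Lemma GL2q_ind (Q : A -> Prop) :
    (forall z, Q (GL2q_gen q z)) -> Q ci -> Q 1 ->
    (forall a u v, Q u -> Q v -> Q (a *: u + v)) ->
    (forall u v, Q u -> Q v -> Q (u * v)) ->
  forall u, Q u.
Proof.
move=> Qg Qci Q1 Ql Qm; apply: presAlg_ind => // -[x|[]//].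
rewrite -[pgen _ _]/(adjoin_in _ x).
elim/presAlg_ind: x => [z||a u v|u v].
- exact: Qg.
- by rewrite adjoin_in1.
- by rewrite adjoin_in_lin; exact: Ql.
- by rewrite adjoin_inM; exact: Qm.
Qed.

Hypothesis q0 : qC != 0.

Lemma be_al : qcomm qC^-1 be al. Proof. exact/qcomm_sym/al_be. Qed.
Lemma ga_al : qcomm qC^-1 ga al. Proof. exact/qcomm_sym/al_ga. Qed.
Lemma de_be : qcomm qC^-1 de be. Proof. exact/qcomm_sym/be_de. Qed.
Lemma de_ga : qcomm qC^-1 de ga. Proof. exact/qcomm_sym/ga_de. Qed.

Lemma al_y : al * (be * ga) = qC ^+ 2 *: (be * ga * al).
Proof. by have := qcommMr al_be al_ga; rewrite /qcomm -expr2. Qed.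
Lemma y_de : be * ga * de = qC ^+ 2 *: (de * (be * ga)).
Proof. by have := qcommMl be_de ga_de; rewrite /qcomm -expr2. Qed.

Lemma c_def_de_al : c = de * al - qC^-1 *: (be * ga).
Proof. by rewrite de_al addrK. Qed.

(** Commuting alpha or delta past c turns the expression al * de - q be * ga of c
    into its other expression de * al - q^-1 be * ga. *)
Lemma c_gen z : GRing.comm c (GL2q_gen q z).
Proof.
case: z; rewrite /GRing.comm -/al -/be -/ga -/de.
- rewrite [in RHS]c_def_de_al c_def mulrBl mulrBr presZl presZr mulrA al_y scalerA.
  by rewrite (_ : qC^-1 * qC ^+ 2 = qC) ?mulrA //; field.
- rewrite c_def mulrBl mulrBr; congr (_ - _).
    by have := qcommMl al_be de_be; rewrite mulfV // => /qcomm1.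
  by rewrite presZl presZr [in RHS]mulrA -(mulrA be ga) -be_ga mulrA.
- rewrite c_def mulrBl mulrBr; congr (_ - _).
    by have := qcommMl al_ga de_ga; rewrite mulfV // => /qcomm1.
  by rewrite presZl presZr [in RHS]mulrA -be_ga.
- rewrite [in LHS]c_def_de_al c_def mulrBl mulrBr presZl presZr mulrA y_de scalerA.
  by rewrite (_ : qC^-1 * qC ^+ 2 = qC) ?mulrA //; field.
Qed.

Lemma c_central u : GRing.comm c u.
Proof.
elim/GL2q_ind: u => [z|||a u v cu cv|u v cu cv]; rewrite /GRing.comm.
- exact: c_gen.
- by rewrite c_ci ci_c.
- by rewrite mulr1 mul1r.
- by rewrite mulrDl mulrDr presZl presZr cu cv.
- by rewrite mulrA cu -mulrA cv mulrA.
Qed.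

Lemma ci_central u : GRing.comm ci u.
Proof.
rewrite /GRing.comm -[u in LHS]mulr1 -c_ci mulrA mulrA -(mulrA ci) -c_central.
by rewrite mulrA ci_c mul1r.
Qed.

(** * Rescaling the generators *)

Section Scaling.
Variable r : C.
Hypothesis r0 : r != 0.

(** The first of two stages: a representation of the quantum matrices, then of their
    localization, in which alpha, beta, gamma and delta act by r times their left
    multiplications. *)
Definition scaling_gen (z : Mgen) (v : A) : A := r *: (GL2q_gen q z * v).

Lemma scaling_gen_linear z : linear (scaling_gen z).
Proof. by move=> a v w; rewrite /scaling_gen mulrDr presZr scalerDr !scalerA mulrC. Qed.

Lemma scaling_gen_rel x y : Mrel q x y ->
  term_op scaling_gen x =1 term_op scaling_gen y.
Proof.
have E z z' v : scaling_gen z (scaling_gen z' v) =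
    (r * r) *: (GL2q_gen q z * GL2q_gen q z' * v).
  by rewrite /scaling_gen presZr scalerA mulrA.
case=> v /=; rewrite !E -/al -/be -/ga -/de.
- by rewrite al_be presZl !scalerA mulrC.
- by rewrite ga_de presZl !scalerA mulrC.
- by rewrite al_ga presZl !scalerA mulrC.
- by rewrite be_de presZl !scalerA mulrC.
- by rewrite be_ga.
- by rewrite al_de_de_al mulrDl presZl scalerDr !scalerA [_ * (r * r)]mulrC.
Qed.

Definition scaling_op0 : Mat2q q -> A -> A := pres_op scaling_gen.

Definition scaling_GLgen (x : Mat2q q + unit) : A -> A :=
  match x with
  | inl u => scaling_op0 u
  | inr _ => fun v => r ^- 2 *: (ci * v)
  end.

Lemma scaling_op0_lin a u u' v :
  scaling_op0 (a *: u + u') v = a *: scaling_op0 u v + scaling_op0 u' v.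
Proof. exact: (pres_op_lin scaling_gen_linear scaling_gen_rel). Qed.

Lemma scaling_op0M u u' v :
  scaling_op0 (u * u') v = scaling_op0 u (scaling_op0 u' v).
Proof. exact: (pres_opM scaling_gen_linear scaling_gen_rel). Qed.

Lemma scaling_op0_gen z v : scaling_op0 (Mat2q_gen q z) v = r *: (GL2q_gen q z * v).
Proof. exact: (pres_op_gen scaling_gen_linear scaling_gen_rel). Qed.

Lemma scaling_op0_qdet v : scaling_op0 (qdet q) v = r ^+ 2 *: (c * v).
Proof.
have E z z' : scaling_op0 (Mat2q_gen q z * Mat2q_gen q z') v =
    r ^+ 2 *: (GL2q_gen q z * GL2q_gen q z' * v).
  by rewrite scaling_op0M !scaling_op0_gen presZr scalerA mulrA expr2.
rewrite /qdet -scaleN1r scalerA addrC scaling_op0_lin !E c_def mulrBl scalerBr.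
by rewrite addrC mulN1r scaleNr presZl !scalerA mulrC.
Qed.

Lemma scaling_GLgen_linear x : linear (scaling_GLgen x).
Proof.
case: x => [u|_] /=; first exact: (pres_op_linear scaling_gen_linear).
by move=> a v w; rewrite mulrDr presZr scalerDr !scalerA mulrC.
Qed.

Lemma scaling_GLgen_rel x y : adjoin_rel (@GLrel R q) x y ->
  term_op scaling_GLgen x =1 term_op scaling_GLgen y.
Proof.
case=> {x y} [a x y||x y|x y []] v /=.
- exact: scaling_op0_lin.
- exact: (pres_op1 scaling_gen_linear scaling_gen_rel).
- exact: scaling_op0M.
- by rewrite scaling_op0_qdet presZr scalerA divff ?expf_neq0 // scale1r mulrA c_ci mul1r.
- by rewrite scaling_op0_qdet presZr scalerA mulVf ?expf_neq0 // scale1r mulrA ci_c mul1r.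
Qed.

(** The automorphism that multiplies alpha, beta, gamma and delta by r. *)
Definition scaling (u : A) : A := pres_op scaling_GLgen u 1.

(** The operators commute with right multiplications, so each of them is the left
    multiplication by its value at 1; multiplicativity of the scaling follows. *)
Lemma scaling_op u v : pres_op scaling_GLgen u v = scaling u * v.
Proof.
have E := pres_op_gen scaling_GLgen_linear scaling_GLgen_rel.
have D := pres_op_lin scaling_GLgen_linear scaling_GLgen_rel.
have M := pres_opM scaling_GLgen_linear scaling_GLgen_rel.
have I := pres_op1 scaling_GLgen_linear scaling_GLgen_rel.
rewrite /scaling; elim/GL2q_ind: u v => [z|||a u u' Hu Hu'|u u' Hu Hu'] v.
- by rewrite /GL2q_gen /adjoin_in !E /= !scaling_op0_gen mulr1 presZl.
- by rewrite /ci_ /adjoin_gen !E /= mulr1 presZl.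
- by rewrite !I mul1r.
- by rewrite !D Hu Hu' mulrDl presZl.
- by rewrite !M Hu' Hu [in RHS]Hu mulrA.
Qed.

Lemma scaling_lin a u v : scaling (a *: u + v) = a *: scaling u + scaling v.
Proof. exact: (pres_op_lin scaling_GLgen_linear scaling_GLgen_rel). Qed.

Lemma scaling1 : scaling 1 = 1.
Proof. exact: (pres_op1 scaling_GLgen_linear scaling_GLgen_rel). Qed.

Lemma scalingM u v : scaling (u * v) = scaling u * scaling v.
Proof.
rewrite {1}/scaling (pres_opM scaling_GLgen_linear scaling_GLgen_rel).
by rewrite scaling_op.
Qed.

Lemma scaling_GL2q_gen z : scaling (GL2q_gen q z) = r *: GL2q_gen q z.
Proof.
rewrite /scaling [pres_op _ _ _](pres_op_gen scaling_GLgen_linear scaling_GLgen_rel).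
by rewrite /= scaling_op0_gen mulr1.
Qed.

Lemma scaling_ci : scaling ci = r ^- 2 *: ci.
Proof.
rewrite /scaling [pres_op _ _ _](pres_op_gen scaling_GLgen_linear scaling_GLgen_rel).
by rewrite /= mulr1.
Qed.

End Scaling.

Lemma scalingK r : r != 0 -> cancel (scaling r) (scaling r^-1).
Proof.
move=> r0 u; have r'0 : r^-1 != 0 by rewrite invr_eq0.
have Z s (s0 : s != 0) a v : scaling s (a *: v) = a *: scaling s v.
  have S0 : scaling s 0 = 0.
    have := scaling_lin s0 (-1) 0 0.
    by rewrite scaler0 addr0 scaleN1r addNr.
  by have := scaling_lin s0 a v 0; rewrite S0 !addr0.
elim/GL2q_ind: u => [z|||a u v cu cv|u v cu cv].
- by rewrite scaling_GL2q_gen // Z // scaling_GL2q_gen // scalerA mulfV // scale1r.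
- rewrite scaling_ci // Z // scaling_ci // scalerA exprVn mulfV ?scale1r //.
  by rewrite invr_eq0 expf_neq0.
- by rewrite !scaling1.
- by rewrite !scaling_lin // cu cv.
- by rewrite !scalingM // cu cv.
Qed.

End GL2q.

(** * The extension by t contains the function algebra *)

Section Hat.
Variables (R : realType) (q : R).
Local Notation C := R[i].
Local Notation qC := (qC q).
Local Notation A := (GL2q q).
Hypothesis q0 : qC != 0.

(** The relation z t = q t z asks of t an operator T with z T = q T z for the left
    multiplications z, and the rescaling by q^-1 is one.  This extends the regular
    module of the function algebra to a module over the extension by t. *)
Definition hat_op_gen (x : A + tgen) : A -> A :=
  match x with
  | inl f => *%R f
  | inr (Tt | Tts) => scaling qC^-1
  | inr (Tti | Ttis) => scaling qC
  end.

Lemma hat_op_gen_linear x : linear (hat_op_gen x).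
Proof.
have qV : qC^-1 != 0 by rewrite invr_eq0.
case: x => [f|[]] a u v /=; first by rewrite mulrDr presZr.
all: exact: scaling_lin.
Qed.

Lemma hat_op_gen_rel x y : adjoin_rel (@hatrel R q) x y ->
  term_op hat_op_gen x =1 term_op hat_op_gen y.
Proof.
have qV : qC^-1 != 0 by rewrite invr_eq0.
have K1 : cancel (scaling qC) (@scaling R q qC^-1) by exact: scalingK.
have K2 : cancel (scaling qC^-1) (@scaling R q qC).
  by have := @scalingK R q _ qV; rewrite invrK.
case=> {x y} [a x y|| x y|x y []] /=; do ?[by move=> v; rewrite ?K1 ?K2].
- by move=> v; rewrite mulrDl presZl.
- by move=> v; rewrite mul1r.
- by move=> v; rewrite mulrA.
- move=> z v; rewrite /= scalingM // scaling_GL2q_gen // presZl scalerA mulfV //.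
  by rewrite scale1r.
- move=> z v; rewrite /= scalingM // scaling_GL2q_gen // presZl scalerA mulfV //.
  by rewrite scale1r.
Qed.

(** An element f is recovered from its image by letting it act on 1. *)
Lemma hat_in_inj : injective (@hat_in R q).
Proof.
have E f : pres_op hat_op_gen (hat_in f) 1 = f.
  by rewrite [LHS](pres_op_gen hat_op_gen_linear hat_op_gen_rel) /= mulr1.
by move=> f g fg; rewrite -(E f) -(E g) fg.
Qed.

Lemma t_ti : t_ q * adjoin_gen (@hatrel R q) Tti = 1.
Proof.
rewrite -[LHS]/(pmul _ _) pmulE.
exact/eq_pclass/cong_rel/adjoin_rel_R/hatrel_tti.
Qed.

Lemma hat_t z : qcomm qC (hat_in (GL2q_gen q z)) (t_ q).
Proof.
rewrite /qcomm -[LHS]/(pmul _ _) -[RHS]/(pscale _ (pmul _ _)) !pmulE pscaleE.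
exact/eq_pclass/cong_rel/adjoin_rel_R/hatrel_zt.
Qed.

(** This is what makes tau at the points q^(-2k) determined by the action on the
    extension by t. *)
Lemma hat_in_ext_inj k f g :
    hat_in f * hat_in (c_ q ^+ k) * t_ q ^+ (2 * k) =
    hat_in g * hat_in (c_ q ^+ k) * t_ q ^+ (2 * k) ->
  f = g.
Proof.
have tK n : t_ q ^+ n * adjoin_gen (@hatrel R q) Tti ^+ n = 1.
  elim: n => [|n IHn]; first by rewrite !expr0 mulr1.
  by rewrite exprSr exprS -mulrA [t_ q * _]mulrA t_ti mul1r.
have cK n : c_ q ^+ n * ci_ q ^+ n = 1.
  elim: n => [|n IHn]; first by rewrite !expr0 mulr1.
  by rewrite exprSr exprS -mulrA [c_ q * _]mulrA c_ci mul1r.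
move=> /(congr1 ( *%R^~ (adjoin_gen (@hatrel R q) Tti ^+ (2 * k)))).
rewrite -!mulrA !tK !mulr1 => /(congr1 ( *%R^~ (hat_in (ci_ q ^+ k)))).
by rewrite /hat_in -!adjoin_inM -!mulrA !cK !mulr1 => /hat_in_inj.
Qed.

End Hat.

(** * Module algebras over the quantum enveloping algebra *)

Section Module.
Variables (R : realType) (q : R) (H : hopf_star_maps (Urel q)).
Local Notation C := R[i].
Local Notation E := (E_ q).
Local Notation F := (F_ q).
Local Notation K := (K_ q).
Local Notation Ki := (Ki_ q).
Hypothesis HH : Uqsl4_hopf_star H.

Lemma K_Ki j : K j * Ki j = 1.
Proof. rewrite -[LHS]/(pmul _ _) pmulE; exact/eq_pclass/cong_rel/Urel_KKi. Qed.
Lemma Ki_K j : Ki j * K j = 1.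
Proof. rewrite -[LHS]/(pmul _ _) pmulE; exact/eq_pclass/cong_rel/Urel_KiK. Qed.
Lemma K_E i j : qcomm (qC q ^ cartan i j) (K i) (E j).
Proof.
rewrite /qcomm -[LHS]/(pmul _ _) -[RHS]/(pscale _ (pmul _ _)) !pmulE pscaleE.
exact/eq_pclass/cong_rel/Urel_KE.
Qed.
Lemma involutionKi j : involution H (Ki j) = Ki j.
Proof.
have [_ i1 iM iI] := involution_star HH.
have iK := involutionK HH j.
have : involution H (K j * Ki j) = 1 by rewrite K_Ki.
rewrite iM iK => e.
by rewrite -[LHS]mulr1 -(K_Ki j) mulrA e mul1r.
Qed.

Section ModuleAlgebra.
Variables (G : Type) (P : term C G -> term C G -> Prop).
Local Notation A := (presAlg P).
Variable (act : Uqsl4 q -> A -> A).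
Hypothesis mod : module_algebra H act.
Implicit Types (f g : A).

Lemma act_lin xi a f g : act xi (a *: f + g) = a *: act xi f + act xi g.
Proof. by case: mod => -[l _ _ _] _ _; exact: l. Qed.
Lemma actl_lin a xi eta f : act (a *: xi + eta) f = a *: act xi f + act eta f.
Proof. by case: mod => -[_ l _ _] _ _; exact: l. Qed.
Lemma act_0 xi : act xi 0 = 0.
Proof. by have := act_lin xi (-1) 0 0; rewrite scaler0 addr0 scaleN1r addNr. Qed.
Lemma act_Z xi a f : act xi (a *: f) = a *: act xi f.
Proof. by have := act_lin xi a f 0; rewrite act_0 !addr0. Qed.
Lemma act_D xi f g : act xi (f + g) = act xi f + act xi g.
Proof. by have := act_lin xi 1 f g; rewrite !scale1r. Qed.
Lemma act_N xi f : act xi (- f) = - act xi f.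
Proof. by rewrite -scaleN1r act_Z scaleN1r. Qed.
Lemma act_1 f : act 1 f = f. Proof. by case: mod => -[]. Qed.
Lemma act_M xi eta f : act (xi * eta) f = act xi (act eta f).
Proof. by case: mod => -[]. Qed.
Lemma actl_0 f : act 0 f = 0.
Proof. by have := actl_lin (-1) 0 0 f; rewrite scaler0 addr0 scaleN1r addNr. Qed.
Lemma actl_Z a xi f : act (a *: xi) f = a *: act xi f.
Proof. by have := actl_lin a xi 0 f; rewrite actl_0 !addr0. Qed.
Lemma actl_N xi f : act (- xi) f = - act xi f.
Proof. by rewrite -scaleN1r actl_Z scaleN1r. Qed.

Lemma act_E j f g : act (E j) (f * g) = act (E j) f * g + act (K j) f * act (E j) g.
Proof.
case: mod => _ _ /(_ (E j) [:: (E j, 1); (K j, E j)]) -> //=.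
  by rewrite !big_cons big_nil addr0 /= act_1.
by rewrite (coproductE HH) !big_cons big_nil addr0.
Qed.

Lemma act_F j f g : act (F j) (f * g) = act (F j) f * act (Ki j) g + f * act (F j) g.
Proof.
case: mod => _ _ /(_ (F j) [:: (F j, Ki j); (1, F j)]) -> //=.
  by rewrite !big_cons big_nil addr0 /= act_1.
by rewrite (coproductF HH) !big_cons big_nil addr0.
Qed.

Lemma act_K j f g : act (K j) (f * g) = act (K j) f * act (K j) g.
Proof.
case: mod => _ _ /(_ (K j) [:: (K j, K j)]) -> //=.
  by rewrite !big_cons big_nil addr0.
by rewrite (coproductK HH) !big_cons big_nil addr0.
Qed.

Lemma act_K_Ki j f : act (K j) (act (Ki j) f) = f.
Proof. by rewrite -act_M K_Ki act_1. Qed.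
Lemma act_Ki_K j f : act (Ki j) (act (K j) f) = f.
Proof. by rewrite -act_M Ki_K act_1. Qed.

(** K_j acts by an automorphism, hence so does its inverse. *)
Lemma act_Ki j f g : act (Ki j) (f * g) = act (Ki j) f * act (Ki j) g.
Proof. by rewrite -[f in LHS](act_K_Ki j) -[g in LHS](act_K_Ki j) -act_K act_Ki_K. Qed.

Lemma act_E1 j : act (E j) 1 = 0.
Proof. by case: mod => _ -> _; rewrite (counitE HH) scale0r. Qed.
Lemma act_F1 j : act (F j) 1 = 0.
Proof. by case: mod => _ -> _; rewrite (counitF HH) scale0r. Qed.
Lemma act_K1 j : act (K j) 1 = 1.
Proof. by case: mod => _ -> _; rewrite (counitK HH) scale1r. Qed.
Lemma Ki_weight j f r : r != 0 -> act (K j) f = r *: f -> act (Ki j) f = r^-1 *: f.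
Proof.
move=> r0 e; rewrite -[f in RHS](act_Ki_K j) e act_Z scalerA mulVf //.
by rewrite scale1r.
Qed.

Lemma K_weightM j f g r s : act (K j) f = r *: f -> act (K j) g = s *: g ->
  act (K j) (f * g) = (r * s) *: (f * g).
Proof. by move=> ef eg; rewrite act_K ef eg presZl presZr scalerA. Qed.

Lemma K_weightX j f r n : act (K j) f = r *: f ->
  act (K j) (f ^+ n) = (r ^+ n) *: (f ^+ n).
Proof.
move=> ef; elim: n => [|n IHn]; first by rewrite !expr0 act_K1 scale1r.
by rewrite !exprS (K_weightM ef IHn).
Qed.

(** In the i-th term of the Leibniz rule, K_j applied to the first i factors gives r^i
    and moving d in front of them gives s^i. *)
Lemma E_pow j (d w : A) a r s n :
    act (E j) w = a *: (d * w) -> act (K j) w = r *: w -> qcomm s w d ->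
  act (E j) (w ^+ n) = (a * \sum_(i < n) (r * s) ^+ i) *: (d * w ^+ n).
Proof.
move=> Ew Kw wd; elim: n => [|n IHn].
  by rewrite !expr0 big_ord0 mulr0 scale0r act_E1.
rewrite exprSr act_E IHn Ew (K_weightX _ Kw) presZl presZl presZr scalerA.
rewrite [w ^+ n * (d * w)]mulrA (qcommXl n wd) presZl scalerA -!mulrA -scalerDl -exprSr.
by rewrite big_ord_recr /= exprMn; congr (_ *: _); ring.
Qed.

Lemma F_pow j (d w : A) b r n :
    act (F j) w = b *: (d * w) -> act (Ki j) w = r *: w -> GRing.comm w d ->
  act (F j) (w ^+ n) = (b * \sum_(i < n) r ^+ i) *: (d * w ^+ n).
Proof.
move=> Fw Kw wd; elim: n => [|n IHn].
  by rewrite !expr0 big_ord0 mulr0 scale0r act_F1.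
rewrite exprSr act_F IHn Fw Kw presZl !presZr scalerA -[d * _ * w]mulrA -exprSr.
have -> : w ^+ n * (d * w) = d * w ^+ n.+1.
  by rewrite mulrA -(commrX n (commr_sym wd)) -mulrA -exprSr.
rewrite -scalerDl big_ord_recl mulrDr expr0 mulr1 addrC -mulrA mulr_suml.
by congr ((_ + _ * _) *: _); apply: eq_bigr => i _; rewrite exprSr.
Qed.

End ModuleAlgebra.
End Module.

(** * Weights and the quantum determinant *)

Section Scalars.
Variables (R : realType) (q : R).
Hypotheses (q_gt0 : 0 < q) (q_lt1 : q < 1).
Local Notation C := R[i].
Local Notation qC := (qC q).
Local Notation s := (sqrtqC q).

Lemma geom_sum (r : C) n : (1 - r) * \sum_(i < n) r ^+ i = 1 - r ^+ n.
Proof. by apply: oppr_inj; rewrite -mulNr !opprB [RHS]subrX1. Qed.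

Lemma qC_sqrt : qC = s ^+ 2.
Proof. by rewrite /sqrtqC -rmorphXn /= sqr_sqrtr // ltW. Qed.

Lemma qC_gt0 : 0 < qC.
Proof. by rewrite /Defs.qC ltcR. Qed.

Lemma qC_neq0 : qC != 0.
Proof. by rewrite gt_eqF // qC_gt0. Qed.

Lemma sqrtqC_neq0 : s != 0.
Proof. by apply: contraNneq qC_neq0 => s0; rewrite qC_sqrt s0 expr0n. Qed.

Lemma qC_neq1 : qC != 1.
Proof. by rewrite -[1]/(1%:C) (inj_eq (@complexI _)) lt_eqF. Qed.

Lemma qC_exp_eq1 (n : int) : (qC ^ n == 1) = (n == 0).
Proof. by rewrite pexprz_eq1 ?ltW ?qC_gt0 // (negPf qC_neq1) orbF. Qed.

Lemma onem_qC2 : 1 - qC ^+ 2 != 0.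
Proof. by rewrite subr_eq0 eq_sym (qC_exp_eq1 2). Qed.

End Scalars.

Section Unitarity.
Variables (R : realType) (q : R) (H : hopf_star_maps (Urel q)).
Variables (act : Uqsl4 q -> GL2q q -> GL2q q) (star : GL2q q -> GL2q q).
Hypotheses (q_gt0 : 0 < q) (q_lt1 : q < 1).
Hypothesis HH : Uqsl4_hopf_star H.
Hypothesis HP : PolSU_structure H act star.
Local Notation C := R[i].
Local Notation qC := (qC q).
Local Notation s := (sqrtqC q).
Local Notation A := (GL2q q).
Local Notation al := (al q).
Local Notation be := (be q).
Local Notation ga := (ga q).
Local Notation de := (de q).
Local Notation c := (c_ q).
Local Notation ci := (ci_ q).
Local Notation E := (E_ q).
Local Notation F := (F_ q).
Local Notation K := (K_ q).
Local Notation Ki := (Ki_ q).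
Let q0 : qC != 0 := qC_neq0 q_gt0.
Let s0 : s != 0 := sqrtqC_neq0 q_gt0.
Let qs : qC = s ^+ 2 := qC_sqrt q_gt0.
Let ci_central := @ci_central R q q0.
Let c_central := @c_central R q q0.
Let mod : module_algebra H act.
Proof. by case: (PolSU_module HP). Qed.
Let HE := act_E HH mod.
Let HF := act_F HH mod.
Let HK := act_K HH mod.

Definition has_weight (n1 n2 n3 : int) (f : A) : Prop :=
  [/\ act (K j1) f = qC ^ n1 *: f, act (K j2) f = qC ^ n2 *: f &
      act (K j3) f = qC ^ n3 *: f].

Lemma has_weightM a b d a' b' d' f g : has_weight a b d f -> has_weight a' b' d' g ->
  has_weight (a + a') (b + b') (d + d') (f * g).
Proof.
by case=> f1 f2 f3 [g1 g2 g3]; split; rewrite expfzDr //; apply: (K_weightM HH mod).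
Qed.

Lemma has_weightX a b d f n : has_weight a b d f ->
  has_weight (a * n%:Z) (b * n%:Z) (d * n%:Z) (f ^+ n).
Proof.
by case=> f1 f2 f3; split; rewrite -exprz_exp; apply: (K_weightX HH mod).
Qed.

Lemma weight_al : has_weight 1 0 1 al.
Proof.
by case: (actK1 HP) (actK2 HP) (actK3 HP) => + _ _ _ [+ _ _ _] [+ _ _ _];
  split; rewrite ?expr0z ?scale1r.
Qed.
Lemma weight_be : has_weight (-1) 1 1 be.
Proof.
by case: (actK1 HP) (actK2 HP) (actK3 HP) => _ + _ _ [_ + _ _] [_ + _ _]; split.
Qed.
Lemma weight_ga : has_weight 1 1 (-1) ga.
Proof.
by case: (actK1 HP) (actK2 HP) (actK3 HP) => _ _ + _ [_ _ + _] [_ _ + _]; split.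
Qed.
Lemma weight_de : has_weight (-1) 2 (-1) de.
Proof.
by case: (actK1 HP) (actK2 HP) (actK3 HP) => _ _ _ + [_ _ _ +] [_ _ _ +]; split.
Qed.

Lemma weight_c : has_weight 0 2 0 c.
Proof.
have [a1 a2 a3] := has_weightM weight_al weight_de.
have [b1 b2 b3] := has_weightM weight_be weight_ga.
split; rewrite c_def (act_D mod) (act_N mod) (act_Z mod).
- by rewrite a1 b1 scalerBr !scalerA [qC * _]mulrC.
- by rewrite a2 b2 scalerBr !scalerA [qC * _]mulrC.
- by rewrite a3 b3 scalerBr !scalerA [qC * _]mulrC.
Qed.

Lemma weight_ci : has_weight 0 (-2) 0 ci.
Proof.
have W j n : act (K j) c = qC ^ n *: c -> act (K j) ci = qC ^ (- n) *: ci.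
  move=> e; have qn0 : qC ^ n != 0 by rewrite expfz_neq0.
  have : act (K j) (c * ci) = 1 by rewrite c_ci (act_K1 HH mod).
  rewrite HK e presZl => /(congr1 (fun u => qC ^ (- n) *: (ci * u))).
  by rewrite presZr scalerA -expfzDr // addNr expr0z scale1r mulrA ci_c mul1r mulr1.
have [c1 c2 c3] := weight_c.
by split; [exact: (W _ _ c1)|exact: (W _ _ c2)|exact: (W _ _ c3)].
Qed.

Lemma weight_E2 a b d f : has_weight a b d f ->
  has_weight (a - 1) (b + 2) (d - 1) (act (E j2) f).
Proof.
have W i n : act (K i) f = qC ^ n *: f ->
    act (K i) (act (E j2) f) = qC ^ (n + cartan i j2) *: act (E j2) f.
  move=> e; rewrite -(act_M mod) K_E (actl_Z mod) (act_M mod) e (act_Z mod) scalerA.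
  by rewrite -expfzDr // addrC.
by case=> f1 f2 f3; split; [exact: (W j1)|exact: (W j2)|exact: (W j3)].
Qed.

(** The element beta gamma c^-1 of weight zero, on whose powers the integral will be
    computed. *)
Definition bgc : A := be * ga * ci.

Lemma weight_bgc : has_weight 0 0 0 bgc.
Proof. exact: (has_weightM (has_weightM weight_be weight_ga) weight_ci). Qed.

Lemma al_bgc : al * bgc = qC ^+ 2 *: (bgc * al).
Proof. by rewrite /bgc mulrA al_y presZl -!mulrA ci_central. Qed.
Lemma bgc_de : bgc * de = qC ^+ 2 *: (de * bgc).
Proof. by rewrite /bgc -mulrA ci_central mulrA y_de presZl !mulrA. Qed.
Lemma bgc_be : GRing.comm bgc be.
Proof.
have y_be : GRing.comm (be * ga) be by rewrite /GRing.comm -mulrA -be_ga.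
by rewrite /GRing.comm /bgc -mulrA ci_central mulrA y_be -mulrA.
Qed.
Lemma al_de_ci : al * de * ci = 1 + qC *: bgc.
Proof. by rewrite al_de mulrDl presZl c_ci. Qed.
Lemma de_al_ci : de * al * ci = 1 + qC^-1 *: bgc.
Proof. by rewrite de_al mulrDl presZl c_ci. Qed.

Lemma ord3_cases (j : 'I_3) : [\/ j = j1, j = j2 | j = j3].
Proof.
case: j => [[|[|[|n]]] p] //.
- by apply: Or31; apply: val_inj.
- by apply: Or32; apply: val_inj.
- by apply: Or33; apply: val_inj.
Qed.

Lemma act_E_c j : j != j2 -> act (E j) c = 0.
Proof.
case: (ord3_cases j) => -> // _; rewrite c_def (act_D mod) (act_N mod) (act_Z mod) !HE.
- case: (actE1 HP) (actK1 HP) => -> -> -> -> [-> -> _ _].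
  by rewrite !mul0r add0r mulr0 addr0 !presZl !presZr !scalerA mulrC subrr.
- case: (actE3 HP) (actK3 HP) => -> -> -> -> [-> -> _ _].
  rewrite !mul0r !add0r !presZl !presZr al_be !scalerA.
  by rewrite (_ : _ * qC = qC * (qC * s^-1)) ?subrr //; ring.
Qed.

Lemma act_F_c j : j != j2 -> act (F j) c = 0.
Proof.
have W i f n : act (K i) f = qC ^ n *: f -> act (Ki i) f = qC ^ (- n) *: f.
  by move/(Ki_weight mod (expfz_neq0 n q0)); rewrite invr_expz.
case: (ord3_cases j) => -> // _; rewrite c_def (act_D mod) (act_N mod) (act_Z mod) !HF.
- case: (actF1 HP) weight_ga weight_de => -> -> -> -> [/W-> _ _] [/W-> _ _].
  by rewrite !mulr0 mul0r add0r addr0 !presZl !presZr !scalerA opprK expr1z mulrC subrr.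
- case: (actF3 HP) weight_ga weight_de => -> -> -> -> [_ _ /W->] [_ _ /W->].
  rewrite !mulr0 !addr0 !presZl !presZr ga_de !scalerA.
  by rewrite opprK expr1z (_ : _ * qC = qC * (s * qC)) ?subrr //; ring.
Qed.

Lemma act_K_c j : j != j2 -> act (K j) c = c.
Proof.
by case: (ord3_cases j) => -> // _; case: weight_c => e1 _ e3;
  rewrite ?e1 ?e3 expr0z scale1r.
Qed.

Lemma act_E_ci j : j != j2 -> act (E j) ci = 0.
Proof.
move=> j2'; have := HE j c ci.
rewrite c_ci (act_E1 HH mod) act_E_c // mul0r add0r act_K_c //.
by move/(congr1 ( *%R ci)); rewrite mulr0 mulrA ci_c mul1r.
Qed.

Lemma act_E2_c : act (E j2) c = - s *: (de * c).
Proof.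
rewrite [c in LHS]c_def (act_D mod) (act_N mod) (act_Z mod) !HE.
case: (actE2 HP) (actK2 HP) => -> -> -> -> [-> -> _ _].
have dey : de * (be * ga) = qC ^- 2 *: (be * ga * de).
  by rewrite y_de scalerA mulVf ?scale1r // expf_neq0.
have bedega : be * (de * ga) = qC ^- 1 *: (be * ga * de).
  rewrite mulrA be_de presZl -mulrA dey scalerA; congr (_ *: _); field; exact: q0.
rewrite -c_central c_def mulrBl expr2 !presZl !presZr bedega -(mulrA de be) dey mulrA.
rewrite scalerBr !scalerDr !scalerA -scalerDl addrAC -scalerBl addrC -scaleNr.
by congr (_ + _ *: _); rewrite qs; field.
Qed.

Lemma act_F2_c : act (F j2) c = s *: (al * ci * c).
Proof.
rewrite c_def (act_D mod) (act_N mod) (act_Z mod) !HF.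
case: (actF2 HP) => -> -> -> ->.
by rewrite !mul0r !mulr0 !add0r scaler0 subr0 presZr mulr1 -c_def -mulrA ci_c mulr1.
Qed.

(** * A spanning set of weight vectors *)

Definition qmono b g i j : A := be ^+ b * ga ^+ g * c ^+ i * ci ^+ j.

(** A full normal ordering would require a formula for the product of powers of delta
    and alpha.  As al * de and de * al are both combinations of c and be * ga, monomials
    in which only one of alpha and delta occurs suffice, and the left multiplication by
    a generator takes a single rewriting step. *)
Inductive mono_span : A -> Prop :=
| mono_span_al a b g i j : mono_span (al ^+ a * qmono b g i j)
| mono_span_de a b g i j : mono_span (de ^+ a * qmono b g i j)
| mono_span_lin r u v : mono_span u -> mono_span v -> mono_span (r *: u + v).

Lemma qmono_be b g i j : be * qmono b g i j = qmono b.+1 g i j.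
Proof. by rewrite /qmono !mulrA -exprS. Qed.
Lemma qmono_ga b g i j : ga * qmono b g i j = qmono b g.+1 i j.
Proof.
have ga_be : GRing.comm ga be by rewrite /GRing.comm be_ga.
by rewrite /qmono !mulrA (commrX b ga_be) -(mulrA _ ga) -exprS.
Qed.
Lemma qmono_c b g i j : c * qmono b g i j = qmono b g i.+1 j.
Proof.
by rewrite /qmono c_central -mulrA -(commrX j (c_central ci)) exprSr !mulrA.
Qed.
Lemma qmono_ci b g i j : ci * qmono b g i j = qmono b g i j.+1.
Proof. by rewrite /qmono ci_central -mulrA -exprSr. Qed.

Lemma mono_spanZ r u : mono_span u -> mono_span (r *: u).
Proof.
move=> mu; have m0 : mono_span 0.
  by rewrite -(addNr u) -scaleN1r; exact: mono_span_lin.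
by rewrite -[_ *: _]addr0; exact: mono_span_lin.
Qed.

Lemma mono_spanM u v : mono_span v -> mono_span (u * v).
Proof.
move: u v; have Sbe v : mono_span v -> mono_span (be * v).
  elim=> {v} [a b g i j|a b g i j|r u v _ mu _ mv].
  - rewrite mulrA (qcommXr a (be_al q0)) presZl -mulrA qmono_be.
    exact/mono_spanZ/mono_span_al.
  - rewrite mulrA (qcommXr a (be_de _)) presZl -mulrA qmono_be.
    exact/mono_spanZ/mono_span_de.
  - by rewrite mulrDr presZr; exact: mono_span_lin.
have Sga v : mono_span v -> mono_span (ga * v).
  elim=> {v} [a b g i j|a b g i j|r u v _ mu _ mv].
  - rewrite mulrA (qcommXr a (ga_al q0)) presZl -mulrA qmono_ga.
    exact/mono_spanZ/mono_span_al.
  - rewrite mulrA (qcommXr a (ga_de _)) presZl -mulrA qmono_ga.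
    exact/mono_spanZ/mono_span_de.
  - by rewrite mulrDr presZr; exact: mono_span_lin.
have Sc v : mono_span v -> mono_span (c * v).
  elim=> {v} [a b g i j|a b g i j|r u v _ mu _ mv].
  - by rewrite mulrA c_central -mulrA qmono_c; exact: mono_span_al.
  - by rewrite mulrA c_central -mulrA qmono_c; exact: mono_span_de.
  - by rewrite mulrDr presZr; exact: mono_span_lin.
have Scy r v : mono_span v -> mono_span ((c + r *: (be * ga)) * v).
  move=> mv; rewrite mulrDl presZl addrC -mulrA.
  by apply: mono_span_lin; [exact/Sbe/Sga|exact: Sc].
have Sgen z v : mono_span v -> mono_span (GL2q_gen q z * v).
  case: z; [|exact: Sbe|exact: Sga|].
  - elim=> {v} [a b g i j|[|a] b g i j|r u v _ mu _ mv].
    + by rewrite mulrA -exprS; exact: mono_span_al.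
    + by rewrite expr0 mul1r -[GL2q_gen _ _]expr1; exact: mono_span_al.
    + rewrite exprS mulrA [X in X * _]mulrA -/al -/de al_de -mulrA.
      exact/Scy/mono_span_de.
    + by rewrite mulrDr presZr; exact: mono_span_lin.
  - elim=> {v} [[|a] b g i j|a b g i j|r u v _ mu _ mv].
    + by rewrite expr0 mul1r -[GL2q_gen _ _]expr1; exact: mono_span_de.
    + rewrite exprS mulrA [X in X * _]mulrA -/al -/de de_al -mulrA.
      exact/Scy/mono_span_al.
    + by rewrite mulrA -exprS; exact: mono_span_de.
    + by rewrite mulrDr presZr; exact: mono_span_lin.
elim/GL2q_ind=> [z|||r u u' Hu Hu'|u u' Hu Hu'] v mv.
- exact: Sgen.
- elim: mv => {v} [a b g i j|a b g i j|r u v _ mu _ mv].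
  + by rewrite mulrA ci_central -mulrA qmono_ci; exact: mono_span_al.
  + by rewrite mulrA ci_central -mulrA qmono_ci; exact: mono_span_de.
  + by rewrite mulrDr presZr; exact: mono_span_lin.
- by rewrite mul1r.
- by rewrite mulrDl presZl; apply: mono_span_lin; [exact: Hu|exact: Hu'].
- by rewrite -mulrA; exact/Hu/Hu'.
Qed.

Lemma mono_span_all u : mono_span u.
Proof.
rewrite -[u]mulr1; apply: mono_spanM.
have := mono_span_al 0 0 0 0 0.
by rewrite /qmono !expr0 !mulr1.
Qed.

Lemma weight_qmono b g i j : has_weight (g%:Z - b%:Z)
  (b%:Z + g%:Z + 2 * i%:Z - 2 * j%:Z) (b%:Z - g%:Z) (qmono b g i j).
Proof.
have := has_weightM (has_weightM (has_weightM (has_weightX b weight_be)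
  (has_weightX g weight_ga)) (has_weightX i weight_c)) (has_weightX j weight_ci).
rewrite -/(qmono b g i j); congr (has_weight _ _ _ _); lia.
Qed.

(** * Moments of the invariant integral *)

Variable mu : A -> C.
Hypothesis HI : invariant_integral H act star mu.

Lemma mu_lin a f g : mu (a *: f + g) = a * mu f + mu g.
Proof. exact: (integral_scalar HI). Qed.
Lemma mu_0 : mu 0 = 0.
Proof. by have := mu_lin (-1) 0 0; rewrite scaler0 addr0 mulN1r addNr. Qed.
Lemma mu_Z a f : mu (a *: f) = a * mu f.
Proof. by have := mu_lin a f 0; rewrite mu_0 !addr0. Qed.
Lemma mu_D f g : mu (f + g) = mu f + mu g.
Proof. by have := mu_lin 1 f g; rewrite scale1r mul1r. Qed.

Lemma mu_B f g : mu (f - g) = mu f - mu g.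
Proof. by rewrite -[- g]scaleN1r mu_D mu_Z mulN1r. Qed.

Lemma mu_K j f : mu (act (K j) f) = mu f.
Proof.
rewrite (integral_invariant HI) ?(counitK HH) ?mul1r //.
exact/gen_subalg_in/Uqk_genK.
Qed.

Lemma mu_E j f : j != j2 -> mu (act (E j) f) = 0.
Proof.
move=> j2'; rewrite (integral_invariant HI) ?(counitE HH) ?mul0r //.
exact/gen_subalg_in/Uqk_genE.
Qed.

(** Some K_j multiplies f by a power of q other than 1, and preserves the integral. *)
Lemma mu_weight a b d f : has_weight a b d f -> (a != 0) || (b != 0) || (d != 0) ->
  mu f = 0.
Proof.
have W j n : act (K j) f = qC ^ n *: f -> n != 0 -> mu f = 0.
  move=> e n0; have := mu_K j f; rewrite e mu_Z => /(congr1 (fun z => z - mu f)).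
  rewrite subrr -[X in _ - X]mul1r -mulrBl.
  by move/eqP; rewrite mulf_eq0 subr_eq0 qC_exp_eq1 // (negPf n0) => /eqP.
by case=> f1 f2 f3 /orP[/orP[]|]; [exact: W f1|exact: W f2|exact: W f3].
Qed.

Definition qsum k : C := \sum_(i < k) (qC ^+ 2) ^+ i.

Lemma qsumS k : qsum k.+1 = qsum k + qC ^+ 2 ^+ k.
Proof. exact: big_ord_recr. Qed.

Lemma qsumE k : (1 - qC ^+ 2) * qsum k = 1 - qC ^+ 2 ^+ k.
Proof. exact: geom_sum. Qed.

(** The factor beta on the right recombines with the gamma of E_1(beta gamma), which is
    a multiple of alpha gamma, into a power of bgc. *)
Lemma act_E1_bgc k :
  act (E j1) (bgc ^+ k) * be = (s^-1 * (qsum k.+1 - 1)) *: (bgc ^+ k * al).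
Proof.
elim: k => [|k IHk].
  rewrite qsumS /qsum big_ord0 !expr0 add0r subrr mulr0 scale0r.
  by rewrite (act_E1 HH mod) mul0r.
have Kx : act (K j1) bgc = bgc by case: weight_bgc => + _ _; rewrite expr0z scale1r.
have Ex_be : act (E j1) bgc * be = s^-1 *: (al * bgc).
  rewrite /bgc !HE; case: (actE1 HP) (actK1 HP) => _ -> -> _ _.
  rewrite mulr0 addr0 (act_E_ci (isT : j1 != j2)) mulr0 addr0.
  by rewrite !presZl -!mulrA (ci_central be) (mulrA ga) -be_ga -mulrA.
rewrite exprS HE Kx mulrDl -mulrA -(mulrA bgc) IHk.
rewrite -(commrX k (commr_sym bgc_be)) mulrA Ex_be presZl presZr.
rewrite -(mulrA al) -exprS mulrA -exprS.
rewrite (qcommXr k.+1 al_bgc) scalerA -scalerDl; congr (_ *: _).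
by rewrite [in RHS]qsumS; ring.
Qed.

Let moment k := mu (bgc ^+ k).

(** The integral vanishes on E_1 of the element bgc^k beta delta c^-1, and E_1 of this
    element is a combination of bgc^k and bgc^(k+1). *)
Lemma moment_rec k :
  qsum k.+1 * (moment k + qC * moment k.+1) + qC^-1 * moment k.+1 = 0.
Proof.
have al_de_ci' : al * (de * ci) = 1 + qC *: bgc by rewrite mulrA al_de_ci.
have Ebdc : act (E j1) (be * (de * ci)) =
    s^-1 *: (1 + qC *: bgc) + (s^-1 * qC^-1) *: bgc.
  rewrite !HE; case: (actE1 HP) (actK1 HP) => _ -> _ -> [_ -> _ _].
  rewrite (act_E_ci (isT : j1 != j2)) mulr0 addr0 presZl al_de_ci'.
  by rewrite !presZl presZr scalerA /bgc mulrA [qC^-1 * _]mulrC.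
have := mu_E (bgc ^+ k * (be * (de * ci))) (isT : j1 != j2).
have Kx : act (K j1) (bgc ^+ k) = bgc ^+ k.
  by case: (has_weightX k weight_bgc) => + _ _; rewrite mul0r expr0z scale1r.
rewrite HE Kx Ebdc mulrA act_E1_bgc presZl -mulrA al_de_ci'.
rewrite !mulrDr !presZr !mulrDr !presZr mulr1 -exprSr.
rewrite !(mu_Z, mu_D) -/(moment k) -/(moment k.+1) => e.
apply: (mulfI (invr_neq0 s0)); rewrite mulr0 -[RHS]e; ring.
Qed.

(** The recursion multiplied by 1 - q^2.  In this form the two sides are, up to a power
    of q, the integrals of phi delta and delta phi for phi = alpha c^-1 bgc^k. *)
Lemma moment_modular k :
  qC ^+ 2 ^+ k.+1 * (moment k + qC * moment k.+1) = moment k + qC^-1 * moment k.+1.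
Proof.
have := congr1 ( *%R (1 - qC ^+ 2)) (moment_rec k).
rewrite mulr0 mulrDr mulrA qsumE => e.
by apply: subr0_eq; rewrite -[RHS]oppr0 -[in RHS]e; field; exact: q0.
Qed.

Lemma act_E2_ci : act (E j2) ci = s ^- 3 *: (de * ci).
Proof.
have := HE j2 c ci; rewrite c_ci (act_E1 HH mod) act_E2_c presZl -mulrA c_ci mulr1.
case: weight_c => _ -> _; rewrite presZl.
rewrite scaleNr addrC => /esym/subr0_eq /(congr1 (fun u => qC ^- 2 *: (ci * u))).
rewrite !presZr mulrA ci_c mul1r ci_central !scalerA mulVf ?expf_neq0 // scale1r => ->.
by congr (_ *: _); rewrite qs; field.
Qed.

Lemma act_E2_bgc : act (E j2) bgc = - s *: (de * bgc).
Proof.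
rewrite /bgc !HE HK; case: (actE2 HP) (actK2 HP) => _ -> -> _ [_ -> -> _].
rewrite act_E2_ci !(presZl, presZr) (mulrA be) be_de !(presZl, presZr) scalerA.
rewrite mulrDl !presZl.
rewrite [be * ga * (de * ci)]mulrA y_de !presZl !scalerA -!mulrA -!scalerDl.
by congr (_ *: _); rewrite qs; field.
Qed.

Lemma act_E2_al_bgc k : act (E j2) (al * (ci * bgc ^+ k)) =
  - s^-1 *: bgc ^+ k.+1 + (s ^- 3 * (1 - qsum k)) *: (bgc ^+ k + qC *: bgc ^+ k.+1).
Proof.
have Ex : act (E j2) (bgc ^+ k) = (- s * qsum k) *: (de * bgc ^+ k).
  have Kx : act (K j2) bgc = 1 *: bgc by case: weight_bgc => _ + _; rewrite expr0z.
  rewrite (E_pow HH mod k act_E2_bgc Kx bgc_de); congr ((_ * _) *: _).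
  by apply: eq_bigr => i _; rewrite mul1r.
rewrite !HE Ex act_E2_ci; case: (actE2 HP) (actK2 HP) => -> _ _ _ [-> _ _ _].
case: weight_ci => _ -> _; rewrite !presZl !presZr; congr (_ + _).
  by rewrite mulrA -exprS.
have al_de_ci' : al * (ci * de) = 1 + qC *: bgc by rewrite ci_central mulrA al_de_ci.
rewrite -[de * ci]ci_central -!mulrA (mulrA ci) scalerA -scalerDl presZr !mulrA.
rewrite -(mulrA al) al_de_ci' mulrDl mul1r presZl -exprS -[qC ^ (-2)]/(qC ^- 2).
by congr (_ *: _); rewrite qs; field.
Qed.

Lemma qmono_bgc g i : al * qmono g g i (i + g + 1) = al * (ci * bgc ^+ g).
Proof.
have c_ciX : c ^+ i * ci ^+ i = 1.
  by rewrite -exprMn_comm ?c_ci ?expr1n //; exact: c_central.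
congr (_ * _); rewrite ci_central /bgc exprMn_comm; last exact/commr_sym/ci_central.
rewrite exprMn_comm; last exact: be_ga.
by rewrite /qmono !exprD expr1 !mulrA -(mulrA _ (c ^+ i)) c_ciX mulr1.
Qed.

(** The modular property of the integral for delta, and the failure of invariance under
    E_2.  By weights all the integrals vanish on the spanning monomials other than
    f = alpha c^-1 bgc^g; there they involve the moments of order g and g + 1 only, so
    that the recursion decides. *)
Lemma mu_de_act_E2 f : mu (f * de) = qC ^- 2 * mu (de * f) /\
  mu (act (E j2) f) = s ^- 7 * (1 + qC ^+ 2) * mu (de * f).
Proof.
elim: (mono_span_all f) => {f} [a b g i j|a b g i j|r u v _ [mu1 mu2] _ [mv1 mv2]].
- have wu := has_weightM (has_weightX a weight_al) (weight_qmono b g i j).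
  (* The weight of f opposite to that of delta: a = 1, b = g and j = i + b + 1. *)
  case: (boolP ((a == 1) && (b == g) && (j == i + b + 1))%N); last first.
    move=> ne; split.
    + rewrite (mu_weight (has_weightM wu weight_de)); last by lia.
      by rewrite (mu_weight (has_weightM weight_de wu)) ?mulr0 //; lia.
    + rewrite (mu_weight (weight_E2 wu)); last by lia.
      by rewrite (mu_weight (has_weightM weight_de wu)) ?mulr0 //; lia.
  case/andP=> /andP[/eqP-> /eqP->] /eqP-> {a b wu}.
  rewrite expr1 qmono_bgc.
  have y : qC ^+ 2 ^+ g * (moment g + qC * moment g.+1) =
      qC ^- 2 * (moment g + qC^-1 * moment g.+1).
    by rewrite -moment_modular (exprS _ g); field; exact: q0.
  have -> : mu (de * (al * (ci * bgc ^+ g))) = moment g + qC^-1 * moment g.+1.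
    by rewrite !mulrA de_al_ci mulrDl mul1r presZl -exprS mu_D mu_Z.
  split.
  + rewrite -y -!mulrA (qcommXl g bgc_de) !presZr mu_Z (mulrA ci) ci_central !mulrA.
    by rewrite al_de_ci mulrDl mul1r presZl -exprS mu_D mu_Z.
  rewrite act_E2_al_bgc !(mu_D, mu_Z) -/(moment g) -/(moment g.+1).
  (* The factor 1 - q^2 turns qsum g into a power of q. *)
  apply: (mulfI (onem_qC2 q_gt0 q_lt1)).
  transitivity (- s^-1 * (1 - qC ^+ 2) * moment g.+1 + s ^- 3 *
      ((1 - qC ^+ 2) - (1 - qC ^+ 2) * qsum g) * (moment g + qC * moment g.+1)).
    by ring.
  rewrite qsumE.
  transitivity (- s^-1 * (1 - qC ^+ 2) * moment g.+1
      - s ^- 3 * qC ^+ 2 * (moment g + qC * moment g.+1)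
      + s ^- 3 * (qC ^+ 2 ^+ g * (moment g + qC * moment g.+1))).
    by ring.
  by rewrite y qs; field.
- have wu := has_weightM (has_weightX a weight_de) (weight_qmono b g i j).
  have z1 : mu (de ^+ a * qmono b g i j * de) = 0.
    by rewrite (mu_weight (has_weightM wu weight_de)) //; lia.
  have z2 : mu (de * (de ^+ a * qmono b g i j)) = 0.
    by rewrite (mu_weight (has_weightM weight_de wu)) //; lia.
  rewrite z1 z2 !mulr0; split=> //.
  by rewrite (mu_weight (weight_E2 wu)) //; lia.
- by rewrite mulrDl mulrDr presZl presZr (act_lin mod) !mu_lin mu1 mu2 mv1 mv2;
    split; ring.
Qed.

(** * The operators of the degenerate series *)

Lemma qpow_conj (lambda : C) : complex.Re lambda = 2 ->
  qpow q lambda * (qpow q lambda)^* = qC ^+ 4.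
Proof.
move=> Rl; rewrite /qpow Rl expRM_natl lnK ?posrE //.
set x := complex.Im lambda * ln q.
apply/eqP; rewrite eq_complex -!rmorphXn /=; apply/andP; split; apply/eqP; last by ring.
transitivity (q ^+ 4 * (cos x ^+ 2 + sin x ^+ 2)); first by ring.
by rewrite cos2Dsin2 mulr1.
Qed.

Lemma qpow_nat k : qpow q (- (2 * k)%:R) = (qC ^+ 2 ^+ k)^-1.
Proof.
have -> : - (2 * k)%:R = (- (2 * k)%:R : R)%:C by rewrite rmorphN rmorph_nat.
rewrite /qpow /= mul0r cos0 sin0 mulr1 mulNr expRN expRM_natl lnK ?posrE //.
by rewrite -exprM fmorphV rmorphXn.
Qed.

Lemma qpow_neq0 (lambda : C) : qpow q lambda != 0.
Proof.
rewrite /qpow mulf_neq0 //.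
  by rewrite (inj_eq (@complexI _)) gt_eqF // expR_gt0.
apply/eqP => -[c0 s0']; have := cos2Dsin2 (complex.Im lambda * ln q).
by rewrite c0 s0' expr0n addr0 => /esym/eqP; rewrite oner_eq0.
Qed.

Variables (hact : Uqsl4 q -> hatS q -> hatS q) (hstar : hatS q -> hatS q).
Variable tau : C -> Uqsl4 q -> GL2q q -> GL2q q.
Hypothesis HS : PolhatSU_structure H act star hact hstar.
Hypothesis HT : tau_family hact tau.
Local Notation t := (t_ q).
Local Notation hc := (hat_in c).

Let hmod : module_algebra H hact.
Proof. by case: (PolhatSU_module HS). Qed.

Lemma hat_c_comm : GRing.comm hc (hat_in de) /\ GRing.comm hc (hat_in (al * ci)).
Proof.
by split; rewrite /GRing.comm /hat_in -[LHS]adjoin_inM -[RHS]adjoin_inM c_central.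
Qed.

Lemma hact_K_w j k : hact (K j) (hc ^+ k * t ^+ (2 * k)) = hc ^+ k * t ^+ (2 * k).
Proof.
have [->|j2'] := eqVneq j j2.
  have Kc : hact (K j2) hc = qC ^+ 2 *: hc.
    by rewrite (hact_in HS); case: weight_c => _ -> _; rewrite /hat_in adjoin_inZ.
  have Kt := K_weightX HH hmod (2 * k) (hactK2 HS).
  rewrite (K_weightM HH hmod (K_weightX HH hmod k Kc) Kt).
  by rewrite exprVn -exprM mulfV ?expf_neq0 // scale1r.
have Kc : hact (K j) hc = 1 *: hc by rewrite (hact_in HS) act_K_c // scale1r.
have Kt : hact (K j) t = 1 *: t by rewrite (hactK HS) // scale1r.
rewrite (act_K HH hmod) (K_weightX HH hmod k Kc) (K_weightX HH hmod (2 * k) Kt).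
by rewrite !expr1n !scale1r.
Qed.

Lemma hact_EF_w j k : j != j2 ->
  hact (E j) (hc ^+ k * t ^+ (2 * k)) = 0 /\ hact (F j) (hc ^+ k * t ^+ (2 * k)) = 0.
Proof.
move=> j2'; rewrite (act_E HH hmod) (act_F HH hmod).
have Kc : hact (K j) hc = 1 *: hc by rewrite (hact_in HS) act_K_c // scale1r.
have Kt : hact (K j) t = 1 *: t by rewrite (hactK HS) // scale1r.
have hat0 : @hat_in R q 0 = 0 by exact: adjoin_in0.
have Ec : hact (E j) hc = 0 *: (1 * hc) by rewrite (hact_in HS) act_E_c // hat0 scale0r.
have Fc : hact (F j) hc = 0 *: (1 * hc) by rewrite (hact_in HS) act_F_c // hat0 scale0r.
have Et : hact (E j) t = 0 *: (1 * t) by rewrite (hactE HS) // scale0r.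
have Ft : hact (F j) t = 0 *: (1 * t) by rewrite (hactF HS) // scale0r.
have q1 (u : hatS q) : qcomm 1 u 1 by apply/qcomm1; exact: commr1.
rewrite (E_pow HH hmod _ Ec Kc (q1 _)) (E_pow HH hmod _ Et Kt (q1 _)).
have K'c := Ki_weight hmod (oner_neq0 _) Kc.
have K't := Ki_weight hmod (oner_neq0 _) Kt.
rewrite (F_pow HH hmod _ Fc K'c (commr1 _)) (F_pow HH hmod _ Ft K't (commr1 _)).
by rewrite !mul0r !scale0r !mul0r !mulr0 addr0.
Qed.

(** At z = q^(-2k), kappa z and nu z are the coefficients by which E_2 and F_2 act on
    c^k t^(2k), up to the factors delta and alpha c^-1. *)
Definition kappa (z : C) : C := s * (z - 1) / (1 - qC ^+ 2).
Definition nu (z : C) : C := s * (z^-1 - 1) / (1 - qC ^- 2).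

Lemma onem_qCV2 : 1 - qC ^- 2 != 0.
Proof.
have := onem_qC2 q_gt0 q_lt1; apply: contraNneq => e.
have -> : 1 - qC ^+ 2 = - qC ^+ 2 * (1 - qC ^- 2) by field; exact: q0.
by rewrite e mulr0.
Qed.

(** Both c and t are multiplied by a multiple of delta under E_2; the two geometric sums
    that arise for c^k and t^(2k) combine into an affine function of q^(-2k). *)
Lemma hact_E2_w k : hact (E j2) (hc ^+ k * t ^+ (2 * k)) =
  kappa (qC ^+ 2 ^+ k)^-1 *: (hat_in de * (hc ^+ k * t ^+ (2 * k))).
Proof.
have Kc : hact (K j2) hc = qC ^+ 2 *: hc.
  by rewrite (hact_in HS); case: weight_c => _ -> _; rewrite /hat_in adjoin_inZ.
have Ec : hact (E j2) hc = - s *: (hat_in de * hc).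
  by rewrite (hact_in HS) act_E2_c /hat_in adjoin_inZ adjoin_inM.
have t_de : qcomm qC^-1 t (hat_in de) by exact: (qcomm_sym q0 (hat_t q Md)).
have Et : hact (E j2) t = s ^- 3 *: (hat_in de * t).
  by rewrite (hactE2 HS) t_de scalerA; congr (_ *: _); rewrite qs; field.
have cde : qcomm 1 hc (hat_in de) by apply/qcomm1; case: hat_c_comm.
rewrite (act_E HH hmod) (E_pow HH hmod k Ec Kc cde).
rewrite (E_pow HH hmod (2 * k) Et (hactK2 HS) t_de) (K_weightX HH hmod k Kc).
rewrite !presZl !presZr !mulrA (qcommXl k cde) expr1n scale1r scalerA -!mulrA -scalerDl.
congr (_ *: _); rewrite mulr1 /kappa.
have X0 : qC ^+ 2 ^+ k != 0 by rewrite !expf_neq0.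
have d1 := onem_qC2 q_gt0 q_lt1; have d2 := onem_qCV2.
apply: (mulIf d1); rewrite mulfVK // mulrDl.
have g1 := geom_sum (qC ^+ 2) k; have g2 := geom_sum (qC^-1 * qC^-1) (2 * k).
move: g1 g2; set S1 := \sum_(i < k) _; set S2 := \sum_(i < _) _ => g1 g2.
transitivity (- s * ((1 - qC ^+ 2) * S1)
    + qC ^+ 2 ^+ k * (- s ^- 3 * qC ^+ 2) * ((1 - qC^-1 * qC^-1) * S2)).
  by field; exact/andP.
have e2 : (qC^-1 * qC^-1) ^+ (2 * k) = (qC ^+ 2 ^+ k) ^- 2.
  by rewrite -expr2 -exprM exprVn -!exprM; congr (_ ^- _); lia.
rewrite g1 g2 e2; move: (qC ^+ 2 ^+ k) X0 => X X0; rewrite qs; field.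
by rewrite X0 s0.
Qed.

Lemma hact_F2_w k : hact (F j2) (hc ^+ k * t ^+ (2 * k)) =
  nu (qC ^+ 2 ^+ k)^-1 *: (hat_in (al * ci) * (hc ^+ k * t ^+ (2 * k))).
Proof.
have Kc : hact (Ki j2) hc = qC ^- 2 *: hc.
  apply: (Ki_weight hmod); first by rewrite expf_neq0.
  by rewrite (hact_in HS); case: weight_c => _ -> _; rewrite /hat_in adjoin_inZ.
have Kt : hact (Ki j2) t = qC *: t.
  rewrite -[qC in RHS]invrK; apply: (Ki_weight hmod); first by rewrite invr_eq0.
  exact: (hactK2 HS).
have Fc : hact (F j2) hc = s *: (hat_in (al * ci) * hc).
  by rewrite (hact_in HS) act_F2_c /hat_in adjoin_inZ adjoin_inM.
have Ft : hact (F j2) t = 0 *: (1 * t) by rewrite (hactF2 HS) // scale0r.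
rewrite (act_F HH hmod) (F_pow HH hmod k Fc Kc hat_c_comm.2).
rewrite (F_pow HH hmod (2 * k) Ft Kt (commr1 _)) mul0r scale0r mulr0 addr0.
have qV0 : qC^-1 ^+ (2 * k) != 0 by rewrite expf_neq0 // invr_eq0.
rewrite (Ki_weight hmod qV0 (K_weightX HH hmod (2 * k) (hactK2 HS))) -exprVn invrK.
rewrite !presZr presZl scalerA -!mulrA.
congr (_ *: _); rewrite /nu invrK.
have X0 : qC ^+ 2 ^+ k != 0 by rewrite !expf_neq0.
have d2 := onem_qCV2; apply: (mulIf d2); rewrite mulfVK //.
have g1 := geom_sum (qC ^- 2) k.
transitivity (qC ^+ (2 * k) * s * ((1 - qC ^- 2) * \sum_(i < k) (qC ^- 2) ^+ i)).
  by ring.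
by rewrite g1 exprVn exprM; field.
Qed.

(** A Laurent polynomial in q^lambda is determined by its values at the points q^(-2k).
    Since it is vector-valued, it is paired with a vector by means of the integral; the
    pairing being definite, it suffices to pair the difference of the two sides, at the
    given lambda, with itself. *)
Lemma tau_interpolation xi f a0 a1 a2 :
  (forall k, let z := (qC ^+ 2 ^+ k)^-1 in
    tau z xi f = a0 + z *: a1 + z^-1 *: a2) ->
  forall lambda, let z := qpow q lambda in tau z xi f = a0 + z *: a1 + z^-1 *: a2.
Proof.
move=> tauk lambda z.
have [n [m [a ha]]] := tau_laurent HT xi f.
set v := tau z xi f; set w := _ + _.
apply: subr0_eq; apply/eqP; apply/negP => /negP vw; have := integral_pos_def HI vw.
set g := star _.
(* The factor z^(m + 1) clears z^(- m) and also the inverse of z in front of a2. *)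
pose p : {poly C} := \sum_(i < n) (mu (g * a i)) *: 'X^(i + 1)
  - (mu (g * a0) *: 'X^(m + 1) + mu (g * a1) *: 'X^(m + 2) + mu (g * a2) *: 'X^m).
have pE l : let z := qpow q l in
    p.[z] = z ^+ (m + 1) * mu (g * (tau z xi f - (a0 + z *: a1 + z^-1 *: a2))).
  move=> y; have y0 : y != 0 by exact: qpow_neq0.
  rewrite ha -/y mulrBr mu_B mulrBr /p hornerD hornerN; congr (_ - _).
    rewrite horner_sum.
    have -> : mu (g * (\sum_(i < n) y ^ (i%:Z - m%:Z) *: a i)) =
        \sum_(i < n) y ^ (i%:Z - m%:Z) * mu (g * a i).
      rewrite mulr_sumr (big_morph mu mu_D mu_0).
      by apply: eq_bigr => i _; rewrite presZr mu_Z.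
    rewrite mulr_sumr; apply: eq_bigr => i _; rewrite hornerZ hornerXn mulrA mulrC.
    rewrite [y ^+ (m + 1)]exprnP -expfzDr //; congr (_ * _).
    by rewrite exprnP; congr (_ ^ _); lia.
  rewrite !mulrDr !presZr !mu_D !mu_Z !hornerE !exprD.
  by field.
have p0 : p = 0.
  apply/eqP; apply: contraT => pn0.
  pose zs := [seq qpow q (- (2 * k)%:R) | k <- iota 0 (size p)].
  have := max_poly_roots pn0 (_ : all (root p) zs) (_ : uniq zs).
  rewrite size_map size_iota ltnn => -> //.
    apply/allP => _ /mapP[k _ ->]; rewrite /root pE qpow_nat tauk subrr mulr0.
    by rewrite mu_0 mulr0.
  rewrite map_inj_uniq ?iota_uniq // => i j; rewrite !qpow_nat => /invr_inj.
  by apply: ieexprIn; [rewrite exprn_gt0 ?qC_gt0|rewrite (qC_exp_eq1 q_gt0 q_lt1 2)].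
have := pE lambda; rewrite /= p0 horner0 => /esym/eqP; rewrite mulf_eq0 expf_eq0.
by rewrite (negPf (qpow_neq0 _)) andbF /= => /eqP ->; rewrite ltxx.
Qed.

(** The Leibniz rule for the action on f c^k t^(2k), with the factor c^k t^(2k)
    cancelled on the right. *)
Lemma tau_of_hact j (a b : C) (k : nat) (w := hc ^+ k * t ^+ (2 * k)) :
  hact (K j) w = w ->
  hact (E j) w = a *: (hat_in de * w) -> hact (F j) w = b *: (hat_in (al * ci) * w) ->
  forall f, let z := (qC ^+ 2 ^+ k)^-1 in
  [/\ tau z (K j) f = act (K j) f,
      tau z (E j) f = act (E j) f + a *: (act (K j) f * de) &
      tau z (F j) f = act (F j) f + b *: (f * (al * ci))].
Proof.
move=> Kw Ew Fw f z; rewrite /z -qpow_nat.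
have hcX : hat_in (c ^+ k) = hc ^+ k by exact: adjoin_inX.
have hD u v : hat_in (u + v) = hat_in u + hat_in v :> hatS q by exact: adjoin_inD.
have hZ r u : hat_in (r *: u) = r *: hat_in u :> hatS q by exact: adjoin_inZ.
have hM u v : hat_in (u * v) = hat_in u * hat_in v :> hatS q by exact: adjoin_inM.
split; apply: (hat_in_ext_inj q0 (k := k));
  rewrite (tau_ext HT) hcX -mulrA -[in RHS]mulrA -/w.
- by rewrite (act_K HH hmod) Kw (hact_in HS).
- rewrite (act_E HH hmod) Ew !(hact_in HS) hD hZ hM mulrDl.
  by rewrite presZr presZl (mulrA _ (hat_in de)).
- have K'w : hact (Ki j) w = w by rewrite -{1}Kw (act_Ki_K hmod).
  rewrite (act_F HH hmod) Fw K'w !(hact_in HS) hD hZ (hM f) mulrDl.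
  by rewrite presZr presZl (mulrA _ (hat_in (al * ci))).
Qed.

Variable lambda : C.
Let z := qpow q lambda.

Lemma tau_K j f : tau z (K j) f = act (K j) f.
Proof.
rewrite (tau_interpolation (a0 := act (K j) f) (a1 := 0) (a2 := 0)).
  by rewrite !scaler0 !addr0.
move=> k /=; rewrite !scaler0 !addr0.
have [->|j2'] := eqVneq j j2.
  by case: (tau_of_hact (hact_K_w j2 k) (hact_E2_w k) (hact_F2_w k) f).
have [Ew Fw] := hact_EF_w k j2'.
by case: (tau_of_hact (a := 0) (b := 0) (hact_K_w j k) _ _ f) => //; rewrite scale0r.
Qed.

Lemma tau_EF j f : j != j2 -> tau z (E j) f = act (E j) f /\ tau z (F j) f = act (F j) f.
Proof.
move=> j2'.
have W k : [/\ tau (qC ^+ 2 ^+ k)^-1 (K j) f = act (K j) f,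
      tau (qC ^+ 2 ^+ k)^-1 (E j) f = act (E j) f + 0 *: (act (K j) f * de) &
      tau (qC ^+ 2 ^+ k)^-1 (F j) f = act (F j) f + 0 *: (f * (al * ci))].
  have [Ew Fw] := hact_EF_w k j2'.
  by apply: (tau_of_hact (hact_K_w j k)); rewrite scale0r.
split.
- rewrite (tau_interpolation (a0 := act (E j) f) (a1 := 0) (a2 := 0)).
    by rewrite !scaler0 !addr0.
  by move=> k /=; rewrite !scaler0 !addr0; case: (W k) => _ -> _; rewrite scale0r addr0.
- rewrite (tau_interpolation (a0 := act (F j) f) (a1 := 0) (a2 := 0)).
    by rewrite !scaler0 !addr0.
  by move=> k /=; rewrite !scaler0 !addr0; case: (W k) => _ _ ->; rewrite scale0r addr0.
Qed.

Lemma tau_E2 f : tau z (E j2) f = act (E j2) f + kappa z *: (act (K j2) f * de).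
Proof.
have d := onem_qC2 q_gt0 q_lt1.
set g := _ * de; have k1 y : kappa y = - (s / (1 - qC ^+ 2)) + y * (s / (1 - qC ^+ 2)).
  by rewrite /kappa; field.
rewrite (tau_interpolation (a0 := act (E j2) f - (s / (1 - qC ^+ 2)) *: g)
  (a1 := (s / (1 - qC ^+ 2)) *: g) (a2 := 0)).
  by rewrite scaler0 addr0 scalerA -scaleNr -addrA -scalerDl k1.
move=> k /=; case: (tau_of_hact (hact_K_w j2 k) (hact_E2_w k) (hact_F2_w k) f) => _ -> _.
by rewrite scaler0 addr0 scalerA -scaleNr -addrA -scalerDl k1.
Qed.

Lemma tau_F2 f : tau z (F j2) f = act (F j2) f + nu z *: (f * (al * ci)).
Proof.
have d := onem_qCV2.
set g := f * _; have k1 y : nu y = - (s / (1 - qC ^- 2)) + y^-1 * (s / (1 - qC ^- 2)).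
  by rewrite /nu mulrBr mulr1 mulrBl addrC mulrCA mulrA.
rewrite (tau_interpolation (a0 := act (F j2) f - (s / (1 - qC ^- 2)) *: g)
  (a1 := 0) (a2 := (s / (1 - qC ^- 2)) *: g)).
  by rewrite scaler0 addr0 scalerA -scaleNr -addrA -scalerDl k1.
move=> k /=; case: (tau_of_hact (hact_K_w j2 k) (hact_E2_w k) (hact_F2_w k) f) => _ _ ->.
by rewrite scaler0 addr0 scalerA -scaleNr -addrA -scalerDl k1.
Qed.

(** * Adjointness with respect to the integral *)

Let st : star_operation star.
Proof. by case: (PolSU_module HP). Qed.

Lemma starM f g : star (f * g) = star g * star f.
Proof. by case: st => _ _ + _; apply. Qed.
Lemma star1 : star 1 = 1.
Proof. by case: st. Qed.
Lemma starK : involutive star.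
Proof. by case: st. Qed.
Lemma star_lin a f g : star (a *: f + g) = a^*%R *: star f + star g.
Proof. by case: st => + _ _ _; apply. Qed.
Lemma star0 : star 0 = 0.
Proof. by have := star_lin (-1) 0 0; rewrite scaler0 addr0 rmorphN1 scaleN1r addNr. Qed.
Lemma starZ a f : star (a *: f) = a^*%R *: star f.
Proof. by have := star_lin a f 0; rewrite star0 !addr0. Qed.
Lemma starD f g : star (f + g) = star f + star g.
Proof. by have := star_lin 1 f g; rewrite rmorph1 !scale1r. Qed.
Lemma starN f : star (- f) = - star f.
Proof. by rewrite -scaleN1r starZ rmorphN1 scaleN1r. Qed.

(** Polarization: the integrals of g^* g for g = f + 1 and g = f + i are real. *)
Lemma mu_star f : mu (star f) = (mu f)^*%R.
Proof.
have real g : (mu (star g * g))^*%R = mu (star g * g).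
  have [->|g0] := eqVneq g 0; first by rewrite mulr0 mu_0 rmorph0.
  by apply/CrealP; rewrite ger0_real // ltW // (integral_pos_def HI).
have ii : ('i%C : C)^*%R = - 'i%C by apply/eqP; rewrite eq_complex /= oppr0 !eqxx.
have i0 : ('i%C : C) != 0 by apply/eqP => -[/eqP]; rewrite oner_eq0.
have := real (f + 1); have := real (f + 'i%C *: (1 : A)); have e0 := real f.
rewrite !starD starZ star1 !mulrDl !mulrDr !(presZl, presZr) !mulr1 !mul1r !(mu_D, mu_Z).
have cD (x y : C) : (x + y)^*%R = x^*%R + y^*%R := rmorphD _ x y.
have cM (x y : C) : (x * y)^*%R = x^*%R * y^*%R := rmorphM _ x y.
have cN (x : C) : (- x)^*%R = - x^*%R := rmorphN _ x.
have c1 : (1 : C)^*%R = 1 := rmorph1 _.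
rewrite (integral_1 HI) !(cD, cM, c1, ii, cN, e0) !mulr1.
set a := mu f; set b := mu (star f); set d := mu (star f * f).
move=> e2 e1; have {}e1 : a^*%R + b^*%R = a + b.
  apply: (addIr (d + 1)); transitivity (d + b^*%R + (a^*%R + 1)); first by ring.
  by rewrite e1; ring.
have {}e2 : a^*%R - b^*%R = b - a.
  apply: (mulfI i0); apply: (addIr (d - 'i%C * 'i%C)).
  transitivity (d + - 'i%C * b^*%R + (- - 'i%C * a^*%R + - - 'i%C * - 'i%C)).
    by ring.
  by rewrite e2; ring.
have n2 : (2 : C) != 0 by rewrite pnatr_eq0.
by apply: (mulfI n2); transitivity ((a + b) + (b - a)); [ring|rewrite -e1 -e2; ring].
Qed.

Lemma mu_starM f g : mu (star f * g) = (mu (star g * f))^*%R.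
Proof. by rewrite -mu_star starM starK. Qed.

Let inv_st : star_operation (involution H) := involution_star HH.

Lemma involM x y : involution H (x * y) = involution H y * involution H x.
Proof. by case: inv_st => _ _ + _; apply. Qed.
Lemma involN x : involution H (- x) = - involution H x.
Proof.
case: inv_st => L _ _ _.
have i0 : involution H 0 = 0.
  by have := L (-1) 0 0; rewrite scaler0 addr0 rmorphN1 scaleN1r addNr.
by have := L (-1) x 0; rewrite !addr0 i0 addr0 rmorphN1 !scaleN1r.
Qed.

Lemma star_act xi f : star (act xi f) = act (involution H (antipode H xi)) (star f).
Proof. by case: (PolSU_module HP). Qed.

Lemma star_K j f : star (act (K j) f) = act (Ki j) (star f).
Proof. by rewrite star_act (antipodeK HH) (involutionKi HH). Qed.

(** Here K_j F_j is the adjoint of E_j.  Applied to g and then starred, it becomes the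
    operator - E_j K_j^{-1} on g^*, to which invariance of the integral applies. *)
Lemma star_KF j f : j != j2 ->
  star (act (K j * F j) f) = - act (E j) (act (Ki j) (star f)).
Proof.
move=> j2'; rewrite star_act (antipode_mul HH) (antipodeF HH) (antipodeK HH).
rewrite mulNr involN !involM (involutionK HH) (involutionF HH) // (involutionKi HH).
by rewrite mulrA Ki_K mul1r (actl_N mod) (act_M mod).
Qed.

Lemma star_KF2 f : star (act (K j2 * F j2) f) = act (E j2) (act (Ki j2) (star f)).
Proof.
rewrite star_act (antipode_mul HH) (antipodeF HH) (antipodeK HH).
rewrite mulNr involN !involM (involutionK HH) (involutionF2 HH) (involutionKi HH).
by rewrite mulrN mulrN mulrA Ki_K mul1r opprK (act_M mod).
Qed.

Lemma qC_conj : qC^*%R = qC.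
Proof. by apply/CrealP; rewrite ger0_real // ltW // qC_gt0. Qed.

Lemma star_ci : star ci = qC ^+ 2 *: c.
Proof.
have star_c : star c = qC ^- 2 *: ci.
  have ciM u v : (ci * u) * (ci * v) = ci * (ci * (u * v)).
    by rewrite -!mulrA (mulrA u) -(ci_central u) !mulrA.
  rewrite c_def starD starN starZ !starM qC_conj (star_al HP) (star_be HP).
  rewrite (star_ga HP) (star_de HP) !presZr !presZl !ciM !scalerA.
  rewrite (_ : qC * _ = qC ^- 2 * qC); last by field; exact: q0.
  by rewrite -scalerA -scalerBr -2!presZr -!mulrBr -c_def ci_c mulr1.
have := star1; rewrite -c_ci starM star_c presZr.
move=> /(congr1 (fun u => qC ^+ 2 *: (u * c))).
by rewrite presZl scalerA mulfV ?expf_neq0 // scale1r -mulrA ci_c mulr1 c_ci mul1r.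
Qed.

Lemma star_al_ci : star (al * ci) = de.
Proof.
rewrite starM star_ci (star_al HP) presZl presZr scalerA mulfV ?expf_neq0 // scale1r.
by rewrite mulrA c_ci mul1r.
Qed.

(** The elements with this property form a subalgebra stable under the involution. *)
Definition adjoint_at (xi : Uqsl4 q) : Prop := forall f g,
  mu (star g * tau z xi f) = mu (star (tau z (involution H xi) g) * f).

Lemma adjoint_K j : adjoint_at (K j).
Proof.
move=> f g; rewrite (involutionK HH) !tau_K star_K.
by rewrite -(mu_K j (_ * f)) HK (act_K_Ki mod).
Qed.

(** For j = 1, 3 the operator tau(E_j) is the action of E_j itself, and adjointness
    is E_j-invariance of the integral, applied to the product of f with the image of
    g^* under K_j^{-1}. *)
Lemma adjoint_E13 j : j != j2 -> adjoint_at (E j).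
Proof.
have [_ _ _ tM] := tau_rep HT lambda.
move=> j2' f g; set h := act (Ki j) (star g).
have gh : star g = act (K j) h by rewrite (act_K_Ki mod).
have [-> _] := tau_EF f j2'; have [_ tF] := tau_EF g j2'.
rewrite (involutionE HH) // tM tau_K tF -(act_M mod) star_KF // -/h gh mulNr.
rewrite -scaleN1r mu_Z mulN1r; apply/eqP; rewrite -addr_eq0 addrC -mu_D -HE.
exact/eqP/mu_E.
Qed.

Hypothesis Re_lambda : complex.Re lambda = 2.

(** On the line Re lambda = 2 one has |z| = q^2, so that complex conjugation replaces
    1 / z by q^{-4} z and the conjugate of nu z becomes affine in z, like kappa z. *)
Lemma nu_conj : (nu z)^*%R = - s * qC ^+ 2 * (qC ^- 4 * z - 1) / (1 - qC ^+ 2).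
Proof.
have zq : z * z^*%R = qC ^+ 4 := qpow_conj Re_lambda.
have z0 : z != 0 := qpow_neq0 lambda.
have s_conj : s^*%R = s by exact: conjc_real.
have cV (x : C) : (x^-1)^*%R = (x^*%R)^-1 := fmorphV _ x.
have cM (x y : C) : (x * y)^*%R = x^*%R * y^*%R := rmorphM _ x y.
have cB (x y : C) : (x - y)^*%R = x^*%R - y^*%R := rmorphB _ x y.
have c1 : (1 : C)^*%R = 1 := rmorph1 _.
have nuC (y : C) : (nu y)^*%R = s * ((y^*%R)^-1 - 1) / (1 - qC ^- 2).
  by rewrite /nu !cM s_conj !cV !cB !cV c1 [in LHS]expr2 cM qC_conj.
have zV : (z^*%R)^-1 = qC ^- 4 * z.
  by rewrite -zq invfM mulrC mulrA mulfV // mul1r.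
have d := onem_qC2 q_gt0 q_lt1; have dV := onem_qCV2.
rewrite nuC zV; apply: (mulIf d); apply: (mulIf dV); field.
by apply/and3P; split; [exact: q0|exact: d|rewrite -opprB oppr_eq0; exact: d].
Qed.

(** Put h = K_2^{-1} g^* and phi = h f.  Invariance under K_2 turns the relation into
    mu(E_2 phi) + q^{-2} (kappa z) mu(phi delta) + q^{-2} (nu z)^* mu(delta phi) = 0,
    where each term is a multiple of mu(delta phi) and the three coefficients cancel. *)
Lemma adjoint_E2 : adjoint_at (E j2).
Proof.
have [_ tl _ tM] := tau_rep HT lambda.
move=> f g; set h := act (Ki j2) (star g).
have gh : star g = act (K j2) h by rewrite (act_K_Ki mod).
have KK u v : mu (act (K j2) u * (act (K j2) v * de)) = qC ^- 2 * mu (u * v * de).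
  rewrite -[in RHS](mu_K j2) !HK; case: weight_de => _ -> _.
  by rewrite presZr mu_Z mulKf ?expf_neq0 // mulrA.
have [mod_de mod_E] := mu_de_act_E2 (h * f).
have starK2 u : star (act (K j2) (u * (al * ci))) =
    qC ^- 2 *: (de * act (Ki j2) (star u)).
  rewrite star_K starM star_al_ci (act_Ki HH mod).
  have [_ Kde _] := weight_de.
  by rewrite (Ki_weight mod _ Kde) ?expf_neq0 // presZl.
have t0 u : tau z 0 u = 0.
  by have := tl u (-1) 0 0; rewrite scaler0 addr0 scaleN1r addNr.
have tN x u : tau z (- x) u = - tau z x u.
  by have := tl u (-1) x 0; rewrite addr0 t0 addr0 !scaleN1r.
rewrite (involutionE2 HH) tN tM tau_K tau_F2 tau_E2.
rewrite (act_D mod) (act_Z mod) starN starD starZ -(act_M mod) star_KF2 starK2.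
rewrite -/h gh (mulrDr (act (K j2) h)) presZr mu_D mu_Z KK mod_de.
rewrite mulNr -scaleN1r mu_Z mulN1r (mulrDl (act (E j2) h)) scalerA presZl mu_D mu_Z.
rewrite -[de * h * f]mulrA; set D := mu (de * (h * f)).
have -> : mu (act (K j2) h * act (E j2) f) =
    s ^- 7 * (1 + qC ^+ 2) * D - mu (act (E j2) h * f).
  by rewrite -mod_E HE mu_D [RHS]addrC addKr.
rewrite nu_conj /kappa; have := onem_qC2 q_gt0 q_lt1; rewrite qs => d.
by field; apply/andP.
Qed.

Lemma adjoint_E j : adjoint_at (E j).
Proof.
by have [->|j2'] := eqVneq j j2; [exact: adjoint_E2|exact: adjoint_E13].
Qed.

Lemma adjointM xi eta : adjoint_at xi -> adjoint_at eta -> adjoint_at (xi * eta).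
Proof.
have [_ _ _ tM] := tau_rep HT lambda.
by move=> Hxi Heta f g; rewrite involM !tM Hxi Heta.
Qed.

Lemma adjoint_lin a xi eta : adjoint_at xi -> adjoint_at eta ->
  adjoint_at (a *: xi + eta).
Proof.
have [_ tl _ _] := tau_rep HT lambda; have [iL _ _ _] := inv_st.
have cK (x : C) : (x^*)%C^*%R = x by exact: conjcK.
move=> Hxi Heta f g; rewrite iL !tl starD starZ cK mulrDr mulrDl presZr presZl.
by rewrite !mu_D !mu_Z Hxi Heta.
Qed.

Lemma adjoint_involution xi : adjoint_at xi -> adjoint_at (involution H xi).
Proof.
have [_ _ _ iK] := inv_st.
by move=> Hxi f g; rewrite iK mu_starM -Hxi -mu_starM.
Qed.

Lemma adjoint_Ki j : adjoint_at (Ki j).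
Proof.
have [_ _ t1 tM] := tau_rep HT lambda.
have KKi u : tau z (K j) (tau z (Ki j) u) = u by rewrite -tM K_Ki t1.
move=> f g; rewrite (involutionKi HH) -[g in LHS]KKi.
by have := adjoint_K j (tau z (Ki j) f) (tau z (Ki j) g); rewrite (involutionK HH) KKi.
Qed.

(** Up to sign, K_j F_j is the adjoint of E_j. *)
Lemma adjoint_F j : adjoint_at (F j).
Proof.
have EE : adjoint_at (K j * F j).
  have := adjoint_involution (adjoint_E j).
  have [->|j2'] := eqVneq j j2; last by rewrite (involutionE HH).
  have A1 : adjoint_at 1.
    by rewrite -(K_Ki q j2); apply: adjointM; [exact: adjoint_K|exact: adjoint_Ki].
  rewrite (involutionE2 HH) => e.
  have A0 : adjoint_at 0.
    by have := adjoint_lin (-1) A1 A1; rewrite scaleN1r addNr.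
  by have := adjoint_lin (-1) e A0; rewrite addr0 scaleN1r opprK.
by rewrite -[F j]mul1r -(Ki_K q j) -mulrA; apply: adjointM => //; exact: adjoint_Ki.
Qed.

Lemma adjoint_everywhere xi : adjoint_at xi.
Proof.
elim/presAlg_ind: xi => [[]||a u v|u v].
- exact: adjoint_E.
- exact: adjoint_F.
- exact: adjoint_K.
- exact: adjoint_Ki.
- by rewrite -(K_Ki q j2); apply: adjointM; [exact: adjoint_K|exact: adjoint_Ki].
- exact: adjoint_lin.
- exact: adjointM.
Qed.

End Unitarity.

Theorem proposition7p2 (R : realType) (q : R)
    (H : hopf_star_maps (Urel q))
    (act : Uqsl4 q -> GL2q q -> GL2q q) (star : GL2q q -> GL2q q)
    (mu : GL2q q -> R[i])
    (hact : Uqsl4 q -> hatS q -> hatS q) (hstar : hatS q -> hatS q)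
    (tau : R[i] -> Uqsl4 q -> GL2q q -> GL2q q)
    (lambda : R[i]) :
  0 < q -> q < 1 ->
  Uqsl4_hopf_star H ->
  PolSU_structure H act star ->
  invariant_integral H act star mu ->
  PolhatSU_structure H act star hact hstar ->
  tau_family hact tau ->
  complex.Re lambda = 2 ->
  unitarizable H (tau (qpow q lambda)) /\
  (forall (xi : Uqsl4 q) (f1 f2 : GL2q q),
     mu (star f2 * tau (qpow q lambda) xi f1) =
     mu (star (tau (qpow q lambda) (involution H xi) f2) * f1)).
Proof.
move=> q_gt0 q_lt1 HH HP HI HS HT Rl.
have adj xi f1 f2 := adjoint_everywhere q_gt0 q_lt1 HH HP HI HS HT Rl xi f1 f2.
split; last exact: adj.
exists (fun v1 v2 => mu (star v2 * v1)); split.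
- by move=> v2 a u v /=; rewrite mulrDr presZr (mu_lin HI).
- by move=> v1 v2; exact: (mu_starM HP HI).
- by move=> v v0; exact: (integral_pos_def HI).
- by move=> xi v1 v2; exact: adj.
Qed.
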